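(* Let $K$ be a commutative unital ring, $G$ a group and $\mathcal A$ a $K$-algebra. (1) Let $\beta$ be a right partial action of $G$ on a $K$-module $X$, and let $Y$ be a $K_{par}G$-$\mathcal A$-bimodule. Then the functors $$(X\otimes_{G_{par}}Y)\otimes_{\mathcal A}-\ :\ \mathcal A\text{-}\mathbf{Mod}\to K\text{-}\mathbf{Mod}\quad\text{and}\quad X\otimes_{G_{par}}(Y\otimes_{\mathcal A}-)\ :\ \mathcal A\text{-}\mathbf{Mod}\to K\text{-}\mathbf{Mod}$$ are isomorphic. (2) Analogously, if $\alpha$ is a left partial action of $G$ on a $K$-module $Y$ and $X$ is an $\mathcal A$-$K_{par}G$-bimodule, then the functors $-\otimes_{\mathcal A}(X\otimes_{G_{par}}Y)$ and $(-\otimes_{\mathcal A}X)\otimes_{G_{par}}Y$ from right $\mathcal A$-modules to $K$-modules are isomorphic.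
   Context: $K$ is a fixed commutative unital ring; $G$ is a group. A left partial action $\alpha=(G,Y,\{Y_g\},\{\alpha_g\})$ of $G$ on a $K$-module $Y$ consists of $K$-submodules $Y_g\subseteq Y$ and $K$-linear isomorphisms $\alpha_g:Y_{g^{-1}}\to Y_g$ such that (i) $Y_1=Y$, $\alpha_1=\mathrm{id}_Y$; (ii) $\alpha_g(Y_{g^{-1}}\cap Y_{g^{-1}h})\subseteq Y_g\cap Y_h$; (iii) $\alpha_g\alpha_h(y)=\alpha_{gh}(y)$ for $y\in Y_{h^{-1}}\cap Y_{h^{-1}g^{-1}}$. A right partial action $\beta=(G,X,\{X_g\},\{\beta_g\})$ on $X$ is a left partial action of $G^{op}$: $K$-submodules $X_g$ and isomorphisms $\beta_g:X_{g^{-1}}\to X_g$, written $x\mapsto(x)\beta_g$, with $X_1=X$, $\beta_1=\mathrm{id}_X$, $(X_h\cap X_{g^{-1}})\beta_g\subseteq X_{hg}\cap X_g$, and $(x)\beta_g\beta_h=(x)\beta_{gh}$ for $x\in X_{h^{-1}g^{-1}}\cap X_{g^{-1}}$. The partial tensor product is $X\otimes_{G_{par}}Y:=(X\otimes_KY)/\mathcal K_{\beta,\alpha}$, where $\mathcal K_{\beta,\alpha}$ is the $K$-submodule generated by all $(x)\beta_g\otimes y-x\otimes\alpha_g(y)$ with $g\in G$, $x\in X_{g^{-1}}$, $y\in Y_{g^{-1}}$. If moreover the right partial action on $X$ is by left $\mathcal A$-modules (domains are submodules, maps are $\mathcal A$-linear), or the left partial action on $Y$ is by right $\mathcal A$-modules,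 then $X\otimes_{G_{par}}Y$ inherits the corresponding $\mathcal A$-module structure. $K_{par}G$ is the $K$-algebra of the monoid $\mathcal S(G)$ with generators $[t]$, $t\in G$, and relations $[1_G]=1$, $[s^{-1}][s][t]=[s^{-1}][st]$, $[s][t][t^{-1}]=[st][t^{-1}]$; $e_g:=[g][g^{-1}]$. A left $K_{par}G$-module $Y$ is always regarded as carrying the induced left partial action $Y_g=e_g\cdot Y$, $\alpha_g(y)=[g]\cdot y$ for $y\in Y_{g^{-1}}$; a right $K_{par}G$-module $X$ carries the induced right partial action $X_g=X\cdot e_{g^{-1}}$, $(x)\beta_g=x\cdot[g]$ for $x\in X_{g^{-1}}$. *)

(* Defs.v *)
From HB Require Import structures.
From mathcomp Require Import all_boot all_order all_algebra.
From mathcomp Require Import boolp classical_sets functions finmap monalg.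

Set Implicit Arguments.
Unset Strict Implicit.
Unset Printing Implicit Defensive.

Import GRing.Theory.
Local Open Scope classical_set_scope.
Local Open Scope quotient_scope.
Local Open Scope ring_scope.

Section Submodule.
Variables (K : pzRingType) (V : lmodType K).

Definition is_submod (W : set V) : Prop := submod_closed [in W].

Lemma submodP (W : set V) :
  is_submod W <-> W 0 /\ (forall k u v, W u -> W v -> W (k *: u + v)).
Proof.
split=> [[W0 Wl]|[W0 Wl]]; split.
- exact: set_mem W0.
- by move=> k u v Wu Wv; apply/set_mem/Wl; apply/mem_set.
- exact/mem_set.
- by move=> k u v /set_mem Wu /set_mem Wv; apply/mem_set/Wl.
Qed.

Definition span (S : set V) : set V :=
  [set v | forall W : set V, is_submod W -> S `<=` W -> W v].

Lemma sub_span (S : set V) : S `<=` span S.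
Proof. by move=> v Sv W _; apply. Qed.

Lemma span_submod (S : set V) : is_submod (span S).
Proof.
apply/submodP; split=> [W WP _|k u v Su Sv W WP SW].
  by case/submodP: WP.
by case/submodP: (WP) => _; apply; [apply: Su|apply: Sv].
Qed.

Lemma spanZ (S : set V) k v : span S v -> span S (k *: v).
Proof.
move=> Sv; have /submodP[S0 Sl] := span_submod S.
by rewrite -[_ *: v]addr0; apply: Sl.
Qed.

Definition in_span (S : set V) : {pred V} := [in span S].

Lemma in_span_zmod (S : set V) : zmod_closed (in_span S).
Proof.
have /submodP[S0 Sl] := span_submod S.
split; first exact/mem_set.
move=> u v /set_mem Su /set_mem Sv; apply/mem_set.
by rewrite addrC -scaleN1r; apply: Sl.
Qed.

HB.instance Definition _ (S : set V) :=
  GRing.isZmodClosed.Build V (in_span S) (in_span_zmod S).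

End Submodule.

Definition quotmod (K : pzRingType) (V : lmodType K) (S : set V) : Type :=
  Quotient.quot (in_span S).

Section QuotMod.
Variables (K : pzRingType) (V : lmodType K) (S : set V).

HB.instance Definition _ := GRing.Zmodule.on (quotmod S).

Definition qpi (v : V) : quotmod S := \pi_(Quotient.quot (in_span S)) v.
Definition qrepr (q : quotmod S) : V :=
  repr (q : Quotient.quot (in_span S)).

Lemma qreprK q : qpi (qrepr q) = q.
Proof. exact: reprK. Qed.

Lemma qpi_eq u v : qpi u = qpi v <-> span S (u - v).
Proof.
split=> [/eqP|uv]; last apply/eqP.
  by rewrite -Quotient.idealrBE => /set_mem.
by rewrite -Quotient.idealrBE; apply/mem_set.
Qed.

Lemma qpiB u v : qpi (u - v) = qpi u - qpi v.
Proof. by rewrite /qpi !piE. Qed.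

Lemma qpiD u v : qpi (u + v) = qpi u + qpi v.
Proof. by rewrite /qpi !piE. Qed.

Definition qscale (k : K) (q : quotmod S) : quotmod S := qpi (k *: qrepr q).

Lemma qscaleE k v : qscale k (qpi v) = qpi (k *: v).
Proof.
apply/qpi_eq; rewrite -scalerBr; apply: spanZ.
by apply/qpi_eq; rewrite qreprK.
Qed.

Fact qscaleA k l q : qscale k (qscale l q) = qscale (k * l) q.
Proof. by rewrite -[q]qreprK !qscaleE scalerA. Qed.
Fact qscale1 : left_id 1 qscale.
Proof. by move=> q; rewrite -[q]qreprK qscaleE scale1r. Qed.
Fact qscaleDr : right_distributive qscale +%R.
Proof.
by move=> k p q; rewrite -[p]qreprK -[q]qreprK !(qscaleE, =^~ qpiD) scalerDr.
Qed.
Fact qscaleDl q : {morph qscale^~ q : k l / k + l}.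
Proof. by move=> k l; rewrite -[q]qreprK !(qscaleE, =^~ qpiD) scalerDl. Qed.

HB.instance Definition _ :=
  GRing.Zmodule_isLmodule.Build K (quotmod S)
    qscaleA qscale1 qscaleDr qscaleDl.

Fact qpi_linear : linear qpi.
Proof. by move=> k u v; rewrite qpiD -qscaleE. Qed.
HB.instance Definition _ :=
  GRing.isLinear.Build K V (quotmod S) *:%R qpi qpi_linear.

Lemma qpi0 s : S s -> qpi s = 0.
Proof.
move=> Ss; rewrite -(linear0 qpi); apply/qpi_eq.
by rewrite subr0; apply: sub_span.
Qed.

Section Lift.
Variables (W : lmodType K) (f : {linear V -> W}).

Definition qlift (f0 : forall s, S s -> f s = 0) (q : quotmod S) : W :=
  f (qrepr q).

Hypothesis f0 : forall s, S s -> f s = 0.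

Lemma qliftE v : qlift f0 (qpi v) = f v.
Proof.
apply/eqP; rewrite /qlift -subr_eq0 -linearB.
have /(_ [set u | f u = 0]) : span S (qrepr (qpi v) - v).
  by apply/qpi_eq; rewrite qreprK.
move=> /(_ _ f0)/= -> //.
apply/submodP; split=> /= [|k x y fx fy]; first exact: linear0.
by rewrite linearP fx fy scaler0 addr0.
Qed.

Fact qlift_linear : linear (qlift f0).
Proof.
move=> k p q; rewrite -[p]qreprK -[q]qreprK -linearP !qliftE.
exact: linearP.
Qed.
HB.instance Definition _ :=
  GRing.isLinear.Build K (quotmod S) W *:%R (qlift f0) qlift_linear.

End Lift.
End QuotMod.

(* The free K-module on T. It is not {malg K[T]} itself because monalg puts a
   module structure on the latter for non-trivial rings only. *)
Definition freemod (K : pzRingType) (T : choiceType) : Type := {malg K[T]}.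

Section FreeMod.
Variables (K : pzRingType) (T : choiceType).

HB.instance Definition _ := GRing.Zmodule.on (freemod K T).

Definition fm_basis (t : T) : freemod K T := mkmalgU t 1.

Definition fm_scale (k : K) (g : freemod K T) : freemod K T :=
  \sum_(t <- msupp g) mkmalgU t (k * mcoeff t g).

Lemma fm_scaleE k (g : freemod K T) t :
  mcoeff t (fm_scale k g) = k * mcoeff t g.
Proof.
rewrite [in RHS](monalgE g) !raddf_sum mulr_sumr.
by apply/eq_bigr=> /= i _; rewrite !mcoeffU mulrnAr.
Qed.

Fact fm_scaleA k l g : fm_scale k (fm_scale l g) = fm_scale (k * l) g.
Proof. by apply/malgP=> t; rewrite !fm_scaleE mulrA. Qed.
Fact fm_scale1 : left_id 1 fm_scale.
Proof. by move=> g; apply/malgP=> t; rewrite fm_scaleE mul1r. Qed.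
Fact fm_scaleDr : right_distributive fm_scale +%R.
Proof.
by move=> k g h; apply/malgP=> t; rewrite !(mcoeffD, fm_scaleE) mulrDr.
Qed.
Fact fm_scaleDl g : {morph fm_scale^~ g : k l / k + l}.
Proof.
by move=> k l; apply/malgP=> t; rewrite !(mcoeffD, fm_scaleE) mulrDl.
Qed.

HB.instance Definition _ :=
  GRing.Zmodule_isLmodule.Build K (freemod K T)
    fm_scaleA fm_scale1 fm_scaleDr fm_scaleDl.

Lemma mcoeff_fmZ k (g : freemod K T) t : mcoeff t (k *: g) = k * mcoeff t g.
Proof. exact: fm_scaleE. Qed.

Lemma fm_basisZ k t : k *: fm_basis t = mkmalgU t k :> freemod K T.
Proof. by apply/malgP=> u; rewrite mcoeff_fmZ !mcoeffU mulrnAr mulr1. Qed.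

Lemma fm_expand (g : freemod K T) :
  g = \sum_(t <- msupp g) mcoeff t g *: fm_basis t.
Proof.
rewrite [LHS](monalgE g); apply: eq_bigr => t _.
by rewrite fm_basisZ.
Qed.

Section Lift.
Variables (W : lmodType K) (h : T -> W).

Definition fm_lift (g : freemod K T) : W :=
  \sum_(t <- msupp g) mcoeff t g *: h t.

Lemma fm_liftEw (g : freemod K T) (d : {fset T}) : fsubset (msupp g) d ->
  fm_lift g = \sum_(t <- d) mcoeff t g *: h t.
Proof.
move=> gd; apply: big_fset_incl => // t _ /mcoeff_outdom ->.
by rewrite scale0r.
Qed.

Fact fm_lift_linear : linear fm_lift.
Proof.
move=> k g g'.
pose d := fsetU (fsetU (msupp g) (msupp g')) (msupp (k *: g + g')).
rewrite !(@fm_liftEw _ d).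
- rewrite scaler_sumr -big_split; apply: eq_bigr => t _ /=.
  by rewrite mcoeffD mcoeff_fmZ scalerDl scalerA.
- by rewrite /d -fsetUA fsetUCA fsubsetUl.
- by rewrite /d -fsetUA fsubsetUl.
- by rewrite /d fsubsetUr.
Qed.
HB.instance Definition _ :=
  GRing.isLinear.Build K (freemod K T) W *:%R fm_lift fm_lift_linear.

Lemma fm_liftE t : fm_lift (fm_basis t) = h t.
Proof.
rewrite (fm_liftEw msuppU_le) big_seq_fset1 mcoeffUU.
exact: scale1r.
Qed.

End Lift.

Lemma fm_ext (W : lmodType K) (f f' : {linear freemod K T -> W}) :
  (forall t, f (fm_basis t) = f' (fm_basis t)) -> f =1 f'.
Proof.
move=> ff' g; rewrite (fm_expand g) !linear_sum; apply: eq_bigr => t _.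
by rewrite !linearZ /= ff'.
Qed.

End FreeMod.

Section Tensor.
Variable K : comPzRingType.

Definition is_bilinear (X Y W : lmodType K) (b : X -> Y -> W) : Prop :=
  (forall y, linear (b^~ y)) /\ (forall x, linear (b x)).

Definition bilinear_rel (X Y : lmodType K) :
    set (freemod K (X * Y)%type) :=
  let e x y := fm_basis K (x, y) in
  [set r | exists k x x' y, r = e (k *: x + x') y - (k *: e x y + e x' y)]
  `|` [set r | exists k x y y', r = e x (k *: y + y') - (k *: e x y + e x y')].

Definition tensK (X Y : lmodType K) : lmodType K :=
  quotmod (bilinear_rel (X := X) (Y := Y)).

Definition tens (X Y : lmodType K) (x : X) (y : Y) : tensK X Y :=
  qpi _ (fm_basis K (x, y)).

Lemma tens_bilinear (X Y : lmodType K) : is_bilinear (@tens X Y).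
Proof.
split=> [y k x x'|x k y y']; rewrite /tens -linearP;
  apply/qpi_eq; apply: sub_span; [left|right].
- by exists k, x, x', y.
- by exists k, x, y, y'.
Qed.

Section Lift.
Variables (X Y W : lmodType K) (b : X -> Y -> W).
Hypothesis bP : is_bilinear b.

Fact tlift_subproof s :
  bilinear_rel s -> fm_lift (fun p : X * Y => b p.1 p.2) s = 0.
Proof.
case: bP => bl br.
case=> [[k [x [x' [y ->]]]]|[k [x [y [y' ->]]]]];
  rewrite linearB linearP /= !fm_liftE /=; apply/eqP; rewrite subr_eq0;
  apply/eqP.
- exact: bl.
- exact: br.
Qed.

Definition tlift (x : tensK X Y) : W := qlift tlift_subproof x.
HB.instance Definition _ :=
  GRing.isLinear.Build K (tensK X Y) W *:%R tlift
    (linearP (qlift tlift_subproof)).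

Lemma tliftE x y : tlift (tens x y) = b x y.
Proof. by rewrite /tlift /tens qliftE /= fm_liftE. Qed.

End Lift.

Lemma tens_ext (X Y W : lmodType K) (f f' : {linear tensK X Y -> W}) :
  (forall x y, f (tens x y) = f' (tens x y)) -> f =1 f'.
Proof.
move=> ff' t; rewrite -[t]qreprK.
pose p : {linear freemod K (X * Y)%type -> tensK X Y} := qpi _.
apply: (@fm_ext _ _ _ (f \o p) (f' \o p)) => -[x y] /=.
exact: ff'.
Qed.

Section Map.
Variables (X X' Y Y' : lmodType K).
Variables (f : {linear X -> X'}) (g : {linear Y -> Y'}).

Fact tmap_subproof : is_bilinear (fun x y => tens (f x) (g y)).
Proof.
have [tl tr] := @tens_bilinear X' Y'.
by split=> [y|x] k u v; rewrite linearP; [apply: tl|apply: tr].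
Qed.

Definition tmap : tensK X Y -> tensK X' Y' := tlift tmap_subproof.
HB.instance Definition _ :=
  GRing.isLinear.Build K _ _ *:%R tmap (linearP (tlift tmap_subproof)).

Lemma tmapE x y : tmap (tens x y) = tens (f x) (g y).
Proof. exact: tliftE. Qed.

End Map.

Section QuotMap.
Variables (X X' Y Y' : lmodType K).
Variables (S : set (tensK X Y)) (S' : set (tensK X' Y')).
Variables (f : {linear X -> X'}) (g : {linear Y -> Y'}).
Hypothesis fgS : forall s, S s -> S' (tmap f g s).

Fact qtmap_subproof s : S s -> (qpi S' \o tmap f g) s = 0.
Proof. by move=> /fgS; apply: qpi0. Qed.

Definition qtmap (q : quotmod S) : quotmod S' := qlift qtmap_subproof q.
HB.instance Definition _ :=
  GRing.isLinear.Build K (quotmod S) (quotmod S') *:%R qtmap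
    (linearP (qlift qtmap_subproof)).

Lemma qtmapE x y : qtmap (qpi S (tens x y)) = qpi S' (tens (f x) (g y)).
Proof. by rewrite /qtmap qliftE /= tmapE. Qed.

End QuotMap.

Section QuotTensorBilinear.
Variables (X Y : lmodType K) (S : set (tensK X Y)).
Local Notation t x y := (qpi S (tens x y)).

Lemma qtensDl x x' y : t (x + x') y = t x y + t x' y.
Proof.
rewrite -linearD; congr (qpi S _).
by have := (tens_bilinear X Y).1 y 1 x x'; rewrite !scale1r.
Qed.

Lemma qtensDr x y y' : t x (y + y') = t x y + t x y'.
Proof.
rewrite -linearD; congr (qpi S _).
by have := (tens_bilinear X Y).2 x 1 y y'; rewrite !scale1r.
Qed.

Lemma qtensZl k x y : t (k *: x) y = k *: t x y.
Proof.
rewrite -linearZ; congr (qpi S _).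
exact: (scalable_linear ((tens_bilinear X Y).1 y)).
Qed.

Lemma qtensZr k x y : t x (k *: y) = k *: t x y.
Proof.
rewrite -linearZ; congr (qpi S _).
exact: (scalable_linear ((tens_bilinear X Y).2 x)).
Qed.

End QuotTensorBilinear.

Lemma qtens_ext (X Y W : lmodType K) (S : set (tensK X Y))
    (f f' : {linear quotmod S -> W}) :
  (forall x y, f (qpi S (tens x y)) = f' (qpi S (tens x y))) -> f =1 f'.
Proof.
move=> ff' q; rewrite -[q]qreprK.
exact: (@tens_ext _ _ _ (f \o qpi S) (f' \o qpi S)).
Qed.

End Tensor.

(* K-algebras. GRing.Algebra only has non-zero algebras, over non-zero rings. *)
Record kalgebra (K : comPzRingType) := KAlgebra {
  kalg_ring :> pzRingType;
  kalg_in : {rmorphism K -> kalg_ring};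
  kalg_central : forall k (a : kalg_ring), kalg_in k * a = a * kalg_in k }.
Arguments kalg_in [K] _.

Section Opposite.
Variables (K : comPzRingType) (A : kalgebra K).

Definition kop_in (k : K) : A^c := kalg_in A k.

Fact kop_in_zmod : zmod_morphism kop_in.
Proof. by move=> k l; rewrite /kop_in rmorphB. Qed.
Fact kop_in_monoid : monoid_morphism kop_in.
Proof.
split=> [|k l]; first exact: (rmorph1 (kalg_in A)).
by rewrite /kop_in mulrC (rmorphM (kalg_in A)).
Qed.
HB.instance Definition _ := GRing.isZmodMorphism.Build K A^c kop_in kop_in_zmod.
HB.instance Definition _ :=
  GRing.isMonoidMorphism.Build K A^c kop_in kop_in_monoid.

Fact kop_central k (a : A^c) : kop_in k * a = a * kop_in k.
Proof. exact: (esym (kalg_central k (a : A))). Qed.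

Definition kop : kalgebra K := @KAlgebra K A^c kop_in kop_central.

End Opposite.

(* lactK and ractK: the A-action induces the given K-action. In particular K
   acts in the same way on both sides of a bimodule. *)
Record lact (K : comPzRingType) (A : kalgebra K) (M : lmodType K) := LAct {
  lact_fun :> A -> M -> M;
  lactDr : forall a m n, lact_fun a (m + n) = lact_fun a m + lact_fun a n;
  lactDl : forall a b m, lact_fun (a + b) m = lact_fun a m + lact_fun b m;
  lact1 : forall m, lact_fun 1 m = m;
  lactM : forall a b m, lact_fun (a * b) m = lact_fun a (lact_fun b m);
  lactK : forall k m, lact_fun (kalg_in A k) m = k *: m }.

Record ract (K : comPzRingType) (A : kalgebra K) (M : lmodType K) := RAct {
  ract_fun :> M -> A -> M;
  ractDl : forall m n a, ract_fun (m + n) a = ract_fun m a + ract_fun n a;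
  ractDr : forall m a b, ract_fun m (a + b) = ract_fun m a + ract_fun m b;
  ract1 : forall m, ract_fun m 1 = m;
  ractM : forall m a b, ract_fun m (a * b) = ract_fun (ract_fun m a) b;
  ractK : forall m k, ract_fun m (kalg_in A k) = k *: m }.

Record bimodule (K : comPzRingType) (A B : kalgebra K) := Bimodule {
  bimod_sort :> lmodType K;
  bimod_l : lact A bimod_sort;
  bimod_r : ract B bimod_sort;
  bimod_comm : forall a m b,
    bimod_r (bimod_l a m) b = bimod_l a (bimod_r m b) }.

Section ActionLinear.
Variables (K : comPzRingType) (A : kalgebra K) (M : lmodType K).

Section Left.
Variables (l : lact A M) (a : A).
Definition lact_lin (m : M) : M := l a m.
Fact lact_lin_subproof : linear lact_lin.
Proof.
move=> k m n; rewrite /lact_lin lactDr; congr (_ + _).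
by rewrite -!(lactK l) -!lactM kalg_central.
Qed.
HB.instance Definition _ :=
  GRing.isLinear.Build K M M *:%R lact_lin lact_lin_subproof.
Lemma lact_linE m : lact_lin m = l a m.
Proof. by []. Qed.

Lemma lact_cancel (b c e : A) m : l e m = m -> b * e = c * e -> l b m = l c m.
Proof. by move=> em bc; rewrite -em -!lactM bc. Qed.
End Left.

Section Right.
Variables (r : ract A M) (a : A).
Definition ract_lin (m : M) : M := r m a.
Fact ract_lin_subproof : linear ract_lin.
Proof.
move=> k m n; rewrite /ract_lin ractDl; congr (_ + _).
by rewrite -!(ractK r) -!ractM kalg_central.
Qed.
HB.instance Definition _ :=
  GRing.isLinear.Build K M M *:%R ract_lin ract_lin_subproof.
Lemma ract_linE m : ract_lin m = r m a.
Proof. by []. Qed.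

Lemma ract_cancel (b c e : A) m : r m e = m -> e * b = e * c -> r m b = r m c.
Proof. by move=> em bc; rewrite -em -!ractM bc. Qed.
End Right.

End ActionLinear.

Definition restr (K : comPzRingType) (A : kalgebra K) (M : lmodType A) : Type :=
  M.

Section Restriction.
Variables (K : comPzRingType) (A : kalgebra K).

Section Module.
Variable M : lmodType A.

HB.instance Definition _ := GRing.Zmodule.on (restr M).

Definition restr_scale (k : K) (m : restr M) : restr M :=
  kalg_in A k *: (m : M).

Fact restr_scaleA k l m :
  restr_scale k (restr_scale l m) = restr_scale (k * l) m.
Proof. by rewrite /restr_scale scalerA rmorphM. Qed.
Fact restr_scale1 : left_id 1 restr_scale.
Proof. by move=> m; rewrite /restr_scale rmorph1 scale1r. Qed.
Fact restr_scaleDr : right_distributive restr_scale +%R.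
Proof. by move=> k m n; rewrite /restr_scale scalerDr. Qed.
Fact restr_scaleDl m : {morph restr_scale^~ m : k l / k + l}.
Proof. by move=> k l; rewrite /restr_scale rmorphD scalerDl. Qed.

HB.instance Definition _ :=
  GRing.Zmodule_isLmodule.Build K (restr M)
    restr_scaleA restr_scale1 restr_scaleDr restr_scaleDl.

Definition restr_lact : lact A (restr M).
Proof.
exists (fun a (m : restr M) => (a *: (m : M) : restr M)).
- by move=> a m n; apply: (@scalerDr A M).
- by move=> a b m; apply: (@scalerDl A M).
- by move=> m; apply: (@scale1r A M).
- by move=> a b m; apply: (esym (@scalerA A M a b m)).
- by [].
Defined.

End Module.

Section Morphism.
Variables (M N : lmodType A) (f : {linear M -> N}).
Definition restr_map (m : restr M) : restr N := f m.
Fact restr_map_linear : linear restr_map.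
Proof. by move=> k m n; apply: (linearP f). Qed.
HB.instance Definition _ :=
  GRing.isLinear.Build K (restr M) (restr N) *:%R restr_map restr_map_linear.
Lemma restr_mapE m : restr_map m = f m.
Proof. by []. Qed.
End Morphism.

End Restriction.

Definition restr_ract (K : comPzRingType) (A : kalgebra K)
  (M : lmodType (kop A)) : ract A (restr M).
Proof.
exists (fun (m : restr M) (a : A) => ((a : kop A) *: (m : M) : restr M)).
- by move=> m n a; apply: (@scalerDr (kop A) M).
- by move=> m a b; apply: (@scalerDl (kop A) M).
- by move=> m; apply: (@scale1r (kop A) M).
- by move=> m a b; apply: (esym (@scalerA (kop A) M b a m)).
- by [].
Defined.

Section TensorAlgebra.
Variables (K : comPzRingType) (A : kalgebra K).

Definition tensA_rel (X N : lmodType K) (r : ract A X) (l : lact A N) :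
    set (tensK X N) :=
  [set t | exists x a n, t = tens (r x a) n - tens x (l a n)].

Definition tensA (X N : lmodType K) (r : ract A X) (l : lact A N) :
  lmodType K := quotmod (tensA_rel r l).

Section Map.
Variables (X X' N N' : lmodType K).
Variables (r : ract A X) (r' : ract A X') (l : lact A N) (l' : lact A N').
Variables (f : {linear X -> X'}) (g : {linear N -> N'}).
Hypothesis fA : forall x a, f (r x a) = r' (f x) a.
Hypothesis gA : forall a n, g (l a n) = l' a (g n).

Fact tensA_map_subproof s : tensA_rel r l s -> tensA_rel r' l' (tmap f g s).
Proof.
case=> x [a [n ->]]; rewrite linearB /= !tmapE fA gA.
by exists (f x), a, (g n).
Qed.

Definition tensA_map : tensA r l -> tensA r' l' := qtmap tensA_map_subproof.
HB.instance Definition _ :=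
  GRing.isLinear.Build K _ _ *:%R tensA_map
    (linearP (qtmap tensA_map_subproof)).

Lemma tensA_mapE x n :
  tensA_map (qpi _ (tens x n)) = qpi _ (tens (f x) (g n)).
Proof. exact: qtmapE. Qed.

End Map.
End TensorAlgebra.

(* lpa_map g is a total function whose values outside lpa_dom g^-1 are
   irrelevant, and likewise rpa_map g outside rpa_dom g^-1; rpa_map g x is
   (x)beta_g. *)
Record lpaction (K : comPzRingType) (G : groupType) (Y : lmodType K) :=
  LPAction {
  lpa_dom : G -> set Y;
  lpa_map : G -> Y -> Y;
  lpa_submod : forall g, is_submod (lpa_dom g);
  lpa_linear : forall g k y z,
    lpa_dom (g^-1)%g y -> lpa_dom (g^-1)%g z ->
    lpa_map g (k *: y + z) = k *: lpa_map g y + lpa_map g z;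
  lpa_bij : forall g, set_bij (lpa_dom (g^-1)%g) (lpa_dom g) (lpa_map g);
  lpa_dom1 : lpa_dom 1%g = setT;
  lpa_map1 : forall y, lpa_map 1%g y = y;
  lpa_sub : forall g h,
    lpa_map g @` (lpa_dom (g^-1)%g `&` lpa_dom (g^-1 * h)%g)
    `<=` lpa_dom g `&` lpa_dom h;
  lpa_mapM : forall g h y,
    (lpa_dom (h^-1)%g `&` lpa_dom (h^-1 * g^-1)%g) y ->
    lpa_map g (lpa_map h y) = lpa_map (g * h)%g y }.

Record rpaction (K : comPzRingType) (G : groupType) (X : lmodType K) :=
  RPAction {
  rpa_dom : G -> set X;
  rpa_map : G -> X -> X;
  rpa_submod : forall g, is_submod (rpa_dom g);
  rpa_linear : forall g k x z,
    rpa_dom (g^-1)%g x -> rpa_dom (g^-1)%g z ->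
    rpa_map g (k *: x + z) = k *: rpa_map g x + rpa_map g z;
  rpa_bij : forall g, set_bij (rpa_dom (g^-1)%g) (rpa_dom g) (rpa_map g);
  rpa_dom1 : rpa_dom 1%g = setT;
  rpa_map1 : forall x, rpa_map 1%g x = x;
  rpa_sub : forall g h,
    rpa_map g @` (rpa_dom h `&` rpa_dom (g^-1)%g)
    `<=` rpa_dom (h * g)%g `&` rpa_dom g;
  rpa_mapM : forall g h x,
    (rpa_dom (h^-1 * g^-1)%g `&` rpa_dom (g^-1)%g) x ->
    rpa_map h (rpa_map g x) = rpa_map (g * h)%g x }.

Definition lpaction_ract (K : comPzRingType) (G : groupType) (Y : lmodType K)
    (A : kalgebra K) (alpha : lpaction G Y) (r : ract A Y) : Prop :=
  (forall g a y, lpa_dom alpha g y -> lpa_dom alpha g (r y a)) /\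
  (forall g a y, lpa_dom alpha (g^-1)%g y ->
     lpa_map alpha g (r y a) = r (lpa_map alpha g y) a).

Definition rpaction_lact (K : comPzRingType) (G : groupType) (X : lmodType K)
    (A : kalgebra K) (beta : rpaction G X) (l : lact A X) : Prop :=
  (forall g a x, rpa_dom beta g x -> rpa_dom beta g (l a x)) /\
  (forall g a x, rpa_dom beta (g^-1)%g x ->
     rpa_map beta g (l a x) = l a (rpa_map beta g x)).

Section PartialTensor.
Variables (K : comPzRingType) (G : groupType).

Definition tensG_rel (X Y : lmodType K) (beta : rpaction G X)
    (alpha : lpaction G Y) : set (tensK X Y) :=
  [set t | exists g x y, [/\ rpa_dom beta (g^-1)%g x, lpa_dom alpha (g^-1)%g y &
     t = tens (rpa_map beta g x) y - tens x (lpa_map alpha g y)]].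

Definition tensG (X Y : lmodType K) (beta : rpaction G X)
    (alpha : lpaction G Y) : lmodType K := quotmod (tensG_rel beta alpha).

Section Map.
Variables (X X' Y Y' : lmodType K).
Variables (beta : rpaction G X) (beta' : rpaction G X').
Variables (alpha : lpaction G Y) (alpha' : lpaction G Y').
Variables (f : {linear X -> X'}) (g : {linear Y -> Y'}).

Definition rpa_morphism : Prop :=
  (forall t x, rpa_dom beta t x -> rpa_dom beta' t (f x)) /\
  (forall t x, rpa_dom beta (t^-1)%g x ->
     f (rpa_map beta t x) = rpa_map beta' t (f x)).

Definition lpa_morphism : Prop :=
  (forall t y, lpa_dom alpha t y -> lpa_dom alpha' t (g y)) /\
  (forall t y, lpa_dom alpha (t^-1)%g y ->
     g (lpa_map alpha t y) = lpa_map alpha' t (g y)).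

Hypotheses (fP : rpa_morphism) (gP : lpa_morphism).

Fact tensG_map_subproof s :
  tensG_rel beta alpha s -> tensG_rel beta' alpha' (tmap f g s).
Proof.
have [[fd fm] [gd gm]] := (fP, gP).
case=> t [x [y [xt yt ->]]]; rewrite linearB /= !tmapE fm // gm //.
by exists t, (f x), (g y); split=> //; [apply: fd|apply: gd].
Qed.

Definition tensG_map : tensG beta alpha -> tensG beta' alpha' :=
  qtmap tensG_map_subproof.
HB.instance Definition _ :=
  GRing.isLinear.Build K _ _ *:%R tensG_map
    (linearP (qtmap tensG_map_subproof)).

Lemma tensG_mapE x y :
  tensG_map (qpi _ (tens x y)) = qpi _ (tens (f x) (g y)).
Proof. exact: qtmapE. Qed.

End Map.

Lemma rpa_morphism_id (X : lmodType K) (beta : rpaction G X) :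
  rpa_morphism beta beta idfun.
Proof. by []. Qed.

Lemma lpa_morphism_id (Y : lmodType K) (alpha : lpaction G Y) :
  lpa_morphism alpha alpha idfun.
Proof. by []. Qed.

End PartialTensor.

Section PartialTensorAction.
Variables (K : comPzRingType) (G : groupType) (A : kalgebra K).
Variables (X Y : lmodType K) (beta : rpaction G X) (alpha : lpaction G Y).

Section Right.
Variables (r : ract A Y) (rP : lpaction_ract alpha r).

Fact tensG_ract_subproof a : lpa_morphism alpha alpha (ract_lin r a).
Proof.
case: rP => rd rm; split=> t y; first exact: rd.
by move=> yt; rewrite /= !ract_linE rm.
Qed.

Definition tensG_ract_fun (t : tensG beta alpha) (a : A) : tensG beta alpha :=
  tensG_map (rpa_morphism_id beta) (tensG_ract_subproof a) t.

Lemma tensG_ractE x y a :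
  tensG_ract_fun (qpi _ (tens x y)) a = qpi _ (tens x (r y a)).
Proof. exact: tensG_mapE. Qed.

Fact tensG_ractDl m n a :
  tensG_ract_fun (m + n) a = tensG_ract_fun m a + tensG_ract_fun n a.
Proof. exact: linearD. Qed.

Local Notation act a :=
  (tensG_map (rpa_morphism_id beta) (tensG_ract_subproof a)).

Fact tensG_ractDr m a b :
  tensG_ract_fun m (a + b) = tensG_ract_fun m a + tensG_ract_fun m b.
Proof.
apply: (qtens_ext (f := act (a + b)) (f' := act a \+ act b)) => x y /=.
by rewrite !tensG_mapE /= !ract_linE ractDr qtensDr.
Qed.

Fact tensG_ract1 m : tensG_ract_fun m 1 = m.
Proof.
apply: (qtens_ext (f := act 1) (f' := idfun)) => x y /=.
by rewrite !tensG_mapE /= !ract_linE ract1.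
Qed.

Fact tensG_ractM m a b :
  tensG_ract_fun m (a * b) = tensG_ract_fun (tensG_ract_fun m a) b.
Proof.
apply: (qtens_ext (f := act (a * b)) (f' := act b \o act a)) => x y /=.
by rewrite !tensG_mapE /= !ract_linE ractM.
Qed.

Fact tensG_ractK m k : tensG_ract_fun m (kalg_in A k) = k *: m.
Proof.
apply: (qtens_ext (f := act (kalg_in A k)) (f' := k \*: idfun)) => x y /=.
by rewrite !tensG_mapE /= !ract_linE ractK qtensZr.
Qed.

Definition tensG_ract : ract A (tensG beta alpha) :=
  RAct tensG_ractDl tensG_ractDr tensG_ract1 tensG_ractM tensG_ractK.

End Right.

Section Left.
Variables (l : lact A X) (lP : rpaction_lact beta l).

Fact tensG_lact_subproof a : rpa_morphism beta beta (lact_lin l a).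
Proof.
case: lP => ld lm; split=> t x; first exact: ld.
by move=> xt; rewrite /= !lact_linE lm.
Qed.

Definition tensG_lact_fun (a : A) (t : tensG beta alpha) : tensG beta alpha :=
  tensG_map (tensG_lact_subproof a) (lpa_morphism_id alpha) t.

Lemma tensG_lactE a x y :
  tensG_lact_fun a (qpi _ (tens x y)) = qpi _ (tens (l a x) y).
Proof. exact: tensG_mapE. Qed.

Fact tensG_lactDr a m n :
  tensG_lact_fun a (m + n) = tensG_lact_fun a m + tensG_lact_fun a n.
Proof. exact: linearD. Qed.

Local Notation act a :=
  (tensG_map (tensG_lact_subproof a) (lpa_morphism_id alpha)).

Fact tensG_lactDl a b m :
  tensG_lact_fun (a + b) m = tensG_lact_fun a m + tensG_lact_fun b m.
Proof.
apply: (qtens_ext (f := act (a + b)) (f' := act a \+ act b)) => x y /=.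
by rewrite !tensG_mapE /= !lact_linE lactDl qtensDl.
Qed.

Fact tensG_lact1 m : tensG_lact_fun 1 m = m.
Proof.
apply: (qtens_ext (f := act 1) (f' := idfun)) => x y /=.
by rewrite !tensG_mapE /= !lact_linE lact1.
Qed.

Fact tensG_lactM a b m :
  tensG_lact_fun (a * b) m = tensG_lact_fun a (tensG_lact_fun b m).
Proof.
apply: (qtens_ext (f := act (a * b)) (f' := act a \o act b)) => x y /=.
by rewrite !tensG_mapE /= !lact_linE lactM.
Qed.

Fact tensG_lactK k m : tensG_lact_fun (kalg_in A k) m = k *: m.
Proof.
apply: (qtens_ext (f := act (kalg_in A k)) (f' := k \*: idfun)) => x y /=.
by rewrite !tensG_mapE /= !lact_linE lactK qtensZl.
Qed.

Definition tensG_lact : lact A (tensG beta alpha) :=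
  LAct tensG_lactDr tensG_lactDl tensG_lact1 tensG_lactM tensG_lactK.

End Left.
End PartialTensorAction.

Section TensorAlgebraAction.
Variables (K : comPzRingType) (A B : kalgebra K).

Section Left.
Variables (Y : bimodule B A) (N : lmodType K) (l : lact A N).

Fact tensA_lact_subproof b y a :
  lact_lin (bimod_l Y) b (bimod_r Y y a) =
  bimod_r Y (lact_lin (bimod_l Y) b y) a.
Proof. by rewrite !lact_linE bimod_comm. Qed.

Fact tensA_lact_id a n : idfun (l a n) = l a (idfun n).
Proof. by []. Qed.

Local Notation act b := (tensA_map (tensA_lact_subproof b) tensA_lact_id).

Definition tensA_lact_fun (b : B) (t : tensA (bimod_r Y) l) :
  tensA (bimod_r Y) l := act b t.

Lemma tensA_lactE b y n :
  tensA_lact_fun b (qpi _ (tens y n)) = qpi _ (tens (bimod_l Y b y) n).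
Proof. exact: tensA_mapE. Qed.

Fact tensA_lactDr b m n :
  tensA_lact_fun b (m + n) = tensA_lact_fun b m + tensA_lact_fun b n.
Proof. exact: linearD. Qed.

Fact tensA_lactDl b c m :
  tensA_lact_fun (b + c) m = tensA_lact_fun b m + tensA_lact_fun c m.
Proof.
apply: (qtens_ext (f := act (b + c)) (f' := act b \+ act c)) => x y /=.
by rewrite !tensA_mapE /= !lact_linE lactDl qtensDl.
Qed.

Fact tensA_lact1 m : tensA_lact_fun 1 m = m.
Proof.
apply: (qtens_ext (f := act 1) (f' := idfun)) => x y /=.
by rewrite !tensA_mapE /= !lact_linE lact1.
Qed.

Fact tensA_lactM b c m :
  tensA_lact_fun (b * c) m = tensA_lact_fun b (tensA_lact_fun c m).
Proof.
apply: (qtens_ext (f := act (b * c)) (f' := act b \o act c)) => x y /=.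
by rewrite !tensA_mapE /= !lact_linE lactM.
Qed.

Fact tensA_lactK k m : tensA_lact_fun (kalg_in B k) m = k *: m.
Proof.
apply: (qtens_ext (f := act (kalg_in B k)) (f' := k \*: idfun)) => x y /=.
by rewrite !tensA_mapE /= !lact_linE lactK qtensZl.
Qed.

Definition tensA_lact : lact B (tensA (bimod_r Y) l) :=
  LAct tensA_lactDr tensA_lactDl tensA_lact1 tensA_lactM tensA_lactK.

End Left.

Section Right.
Variables (M : lmodType K) (r : ract A M) (X : bimodule A B).

Fact tensA_ract_subproof b a x :
  ract_lin (bimod_r X) b (bimod_l X a x) =
  bimod_l X a (ract_lin (bimod_r X) b x).
Proof. by rewrite !ract_linE bimod_comm. Qed.

Fact tensA_ract_id m a : idfun (r m a) = r (idfun m) a.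
Proof. by []. Qed.

Local Notation act b := (tensA_map tensA_ract_id (tensA_ract_subproof b)).

Definition tensA_ract_fun (t : tensA r (bimod_l X)) (b : B) :
  tensA r (bimod_l X) := act b t.

Lemma tensA_ractE m x b :
  tensA_ract_fun (qpi _ (tens m x)) b = qpi _ (tens m (bimod_r X x b)).
Proof. exact: tensA_mapE. Qed.

Fact tensA_ractDl m n b :
  tensA_ract_fun (m + n) b = tensA_ract_fun m b + tensA_ract_fun n b.
Proof. exact: linearD. Qed.

Fact tensA_ractDr m b c :
  tensA_ract_fun m (b + c) = tensA_ract_fun m b + tensA_ract_fun m c.
Proof.
apply: (qtens_ext (f := act (b + c)) (f' := act b \+ act c)) => x y /=.
by rewrite !tensA_mapE /= !ract_linE ractDr qtensDr.
Qed.

Fact tensA_ract1 m : tensA_ract_fun m 1 = m.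
Proof.
apply: (qtens_ext (f := act 1) (f' := idfun)) => x y /=.
by rewrite !tensA_mapE /= !ract_linE ract1.
Qed.

Fact tensA_ractM m b c :
  tensA_ract_fun m (b * c) = tensA_ract_fun (tensA_ract_fun m b) c.
Proof.
apply: (qtens_ext (f := act (b * c)) (f' := act c \o act b)) => x y /=.
by rewrite !tensA_mapE /= !ract_linE ractM.
Qed.

Fact tensA_ractK m k : tensA_ract_fun m (kalg_in B k) = k *: m.
Proof.
apply: (qtens_ext (f := act (kalg_in B k)) (f' := k \*: idfun)) => x y /=.
by rewrite !tensA_mapE /= !ract_linE ractK qtensZr.
Qed.

Definition tensA_ract : ract B (tensA r (bimod_l X)) :=
  RAct tensA_ractDl tensA_ractDr tensA_ract1 tensA_ractM tensA_ractK.

End Right.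
End TensorAlgebraAction.

(* The congruence on words in the letters [t], t in G, generated by the
   defining relations of the monoid S(G). *)
Inductive exel_eq (G : groupType) : seq G -> seq G -> Prop :=
| exel_unit : exel_eq [:: 1%g] [::]
| exel_left s t : exel_eq [:: (s^-1)%g; s; t] [:: (s^-1)%g; (s * t)%g]
| exel_right s t : exel_eq [:: s; t; (t^-1)%g] [:: (s * t)%g; (t^-1)%g]
| exel_refl u : exel_eq u u
| exel_sym u v : exel_eq u v -> exel_eq v u
| exel_trans u v w : exel_eq u v -> exel_eq v w -> exel_eq u w
| exel_cat u u' v v' : exel_eq u u' -> exel_eq v v' ->
    exel_eq (u ++ v) (u' ++ v').

Section ExelMonoid.
Variable G : groupType.

Definition exel_rel (u v : seq G) : bool := `[< exel_eq u v >].

Fact exel_rel_equiv : equiv_class_of exel_rel.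
Proof.
split=> [u|u v|v u w].
- exact/asboolP/exel_refl.
- by apply/asboolP/asboolP => /exel_sym.
- by move=> /asboolP uv /asboolP vw; apply/asboolP/(exel_trans uv).
Qed.
Canonical exel_rel_equiv_rel := EquivRelPack exel_rel_equiv.
Canonical exel_rel_enc := defaultEncModRel exel_rel.

Definition exel_monoid : Type := {eq_quot exel_rel}.
HB.instance Definition _ := Choice.on exel_monoid.

Definition exel_pi (u : seq G) : exel_monoid := \pi_({eq_quot exel_rel}) u.
Definition exel_repr (x : exel_monoid) : seq G :=
  repr (x : {eq_quot exel_rel}).

Lemma exel_reprK x : exel_pi (exel_repr x) = x.
Proof. exact: reprK. Qed.

Lemma exel_piP u v : exel_pi u = exel_pi v <-> exel_eq u v.
Proof.
split=> [/eqmodP/asboolP //|uv]; apply/eqmodP; exact/asboolP.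
Qed.

Definition exel_mul (x y : exel_monoid) : exel_monoid :=
  exel_pi (exel_repr x ++ exel_repr y).

Lemma exel_mulE u v : exel_mul (exel_pi u) (exel_pi v) = exel_pi (u ++ v).
Proof.
by apply/exel_piP; apply: exel_cat; apply/exel_piP; rewrite exel_reprK.
Qed.

Fact exel_mulA : associative exel_mul.
Proof.
move=> x y z; rewrite -[x]exel_reprK -[y]exel_reprK -[z]exel_reprK.
by rewrite !exel_mulE catA.
Qed.
Fact exel_mul1m : left_id (exel_pi [::]) exel_mul.
Proof. by move=> x; rewrite -[x]exel_reprK exel_mulE. Qed.
Fact exel_mulm1 : right_id (exel_pi [::]) exel_mul.
Proof. by move=> x; rewrite -[x]exel_reprK exel_mulE cats0. Qed.

HB.instance Definition _ :=
  isMonoid.Build exel_monoid exel_mulA exel_mul1m exel_mulm1.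

Definition exel_gen (t : G) : exel_monoid := exel_pi [:: t].

Lemma exel_piM u v : (exel_pi u * exel_pi v)%g = exel_pi (u ++ v).
Proof. exact: exel_mulE. Qed.

Lemma exel_gen1 : exel_gen 1%g = 1%g.
Proof. exact/exel_piP/exel_unit. Qed.

Lemma exel_genl s t :
  (exel_gen (s^-1) * exel_gen s * exel_gen t =
   exel_gen (s^-1) * exel_gen (s * t))%g.
Proof. by rewrite /exel_gen !exel_piM; apply/exel_piP/exel_left. Qed.

Lemma exel_genr s t :
  (exel_gen s * exel_gen t * exel_gen (t^-1) =
   exel_gen (s * t) * exel_gen (t^-1))%g.
Proof. by rewrite /exel_gen !exel_piM; apply/exel_piP/exel_right. Qed.

End ExelMonoid.

Definition monoid_alg (K : comPzRingType) (M : monoidType) : Type :=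
  freemod K M.

Section MonoidAlgebra.
Variables (K : comPzRingType) (M : monoidType).
Local Notation KM := (monoid_alg K M).

HB.instance Definition _ := GRing.Lmodule.on KM.

Definition malg_basis (s : M) : KM := fm_basis K s.

Definition malg_mul (g h : KM) : KM :=
  fm_lift (fun s => fm_lift (fun t => malg_basis (s * t)%g) h) g.

Lemma malg_mulE s t :
  malg_mul (malg_basis s) (malg_basis t) = malg_basis (s * t)%g.
Proof. by rewrite /malg_mul !fm_liftE. Qed.

Lemma malg_mul_linl h : linear (malg_mul^~ h).
Proof. by move=> k g g'; rewrite /malg_mul linearP. Qed.

Lemma malg_mul_linr g : linear (malg_mul g).
Proof.
move=> k h h'; rewrite /malg_mul /fm_lift scaler_sumr -big_split.
apply: eq_bigr => s _ /=; rewrite -![X in _ *: X]/(fm_lift _ _) linearP.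
by rewrite scalerDr !scalerA mulrC.
Qed.

Lemma malg_ext (W : lmodType K) (f f' : KM -> W) : linear f -> linear f' ->
  (forall s, f (malg_basis s) = f' (malg_basis s)) -> f =1 f'.
Proof.
move=> fl fl' ff'.
pose F :=
  HB.pack_for {linear KM -> W} f (GRing.isLinear.Build K KM W *:%R f fl).
pose F' :=
  HB.pack_for {linear KM -> W} f' (GRing.isLinear.Build K KM W *:%R f' fl').
exact: (@fm_ext K M W F F').
Qed.

Fact malg_mulA : associative malg_mul.
Proof.
move=> g h i; move: g; apply: malg_ext => [|k g g'|s].
- exact: malg_mul_linl.
- by rewrite [X in malg_mul X i]malg_mul_linl malg_mul_linl.
move: h; apply: malg_ext => [k h h'|k h h'|t].
- by rewrite [X in malg_mul _ X]malg_mul_linl malg_mul_linr.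
- by rewrite [X in malg_mul X i]malg_mul_linr malg_mul_linl.
move: i; apply: malg_ext => [k i i'||u].
- by rewrite [X in malg_mul _ X]malg_mul_linr malg_mul_linr.
- exact: malg_mul_linr.
by rewrite !malg_mulE mulgA.
Qed.

Fact malg_mul1 : left_id (malg_basis 1%g) malg_mul.
Proof.
apply: malg_ext => [|k g g'|s] //; first exact: malg_mul_linr.
by rewrite malg_mulE mul1g.
Qed.

Fact malg_mulr1 : right_id (malg_basis 1%g) malg_mul.
Proof.
apply: malg_ext => [|k g g'|s] //; first exact: malg_mul_linl.
by rewrite malg_mulE mulg1.
Qed.

Fact malg_mulDl : left_distributive malg_mul +%R.
Proof.
by move=> g h i; have := malg_mul_linl i 1 g h; rewrite !scale1r.
Qed.

Fact malg_mulDr : right_distributive malg_mul +%R.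
Proof.
by move=> g h i; have := malg_mul_linr g 1 h i; rewrite !scale1r.
Qed.

HB.instance Definition _ :=
  GRing.Zmodule_isPzRing.Build KM
    malg_mulA malg_mul1 malg_mulr1 malg_mulDl malg_mulDr.

Lemma malg_scaleAl k (g h : KM) : k *: (g * h) = (k *: g) * h.
Proof. exact: esym (scalable_linear (malg_mul_linl h) k g). Qed.

Lemma malg_scaleAr k (g h : KM) : k *: (g * h) = g * (k *: h).
Proof. exact: esym (scalable_linear (malg_mul_linr g) k h). Qed.

Definition malg_in (k : K) : KM := k *: (1 : KM).

Fact malg_in_zmod : zmod_morphism malg_in.
Proof. by move=> k l; rewrite /malg_in scalerBl. Qed.
Fact malg_in_monoid : monoid_morphism malg_in.
Proof.
split=> [|k l]; first by rewrite /malg_in scale1r.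
by rewrite /malg_in -malg_scaleAl mul1r scalerA.
Qed.
HB.instance Definition _ :=
  GRing.isZmodMorphism.Build K KM malg_in malg_in_zmod.
HB.instance Definition _ :=
  GRing.isMonoidMorphism.Build K KM malg_in malg_in_monoid.

Fact malg_central k (g : KM) : malg_in k * g = g * malg_in k.
Proof. by rewrite /malg_in -malg_scaleAl -malg_scaleAr mul1r mulr1. Qed.

Definition monoid_kalg : kalgebra K := KAlgebra malg_central.

Lemma malg_basisM s t :
  malg_basis (s * t)%g = malg_basis s * malg_basis t :> KM.
Proof. exact: esym (malg_mulE s t). Qed.

Lemma malg_basis1 : malg_basis 1%g = 1 :> KM.
Proof. by []. Qed.

End MonoidAlgebra.

(* Unfolding the multiplication in unification is prohibitively slow. *)
Opaque malg_mul.

Section PartialRepresentation.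
Variables (R : pzRingType) (G : groupType) (p : G -> R).
Implicit Types s t g h : G.
Hypothesis p1 : p 1%g = 1.
Hypothesis pl : forall s t,
  p (s^-1)%g * p s * p t = p (s^-1)%g * p (s * t)%g.
Hypothesis pr : forall s t,
  p s * p t * p (t^-1)%g = p (s * t)%g * p (t^-1)%g.
Let e t := p t * p (t^-1)%g.

Lemma prep_el s t : e s * p t = p s * p (s^-1 * t)%g.
Proof. by rewrite /e; have := pl (s^-1)%g t; rewrite invgK. Qed.

Lemma prep_eK t : e t * p t = p t.
Proof. by rewrite prep_el mulVg p1 mulr1. Qed.

Lemma prepVK t : p t * e (t^-1)%g = p t.
Proof. by rewrite /e invgK mulrA prep_eK. Qed.

Lemma prep_ee t : e t * e t = e t.
Proof. by rewrite {2}/e mulrA prep_eK. Qed.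

Lemma prep_eC s t : p s * e t = e (s * t)%g * p s.
Proof. by rewrite prep_el /e mulrA pr invgM -mulgA mulVg mulg1. Qed.

Lemma prep_eCV s t : e t * p s = p s * e (s^-1 * t)%g.
Proof. by rewrite prep_eC mulgA mulgV mul1g. Qed.

Lemma prepMe g h : p g * p h * e (h^-1)%g = p (g * h)%g * e (h^-1)%g.
Proof. by rewrite /e invgK !mulrA pr. Qed.

Lemma prepeM g h : e g * (p g * p h) = e g * p (g * h)%g.
Proof. by rewrite mulrA prep_eK prep_el mulgA mulVg mul1g. Qed.

End PartialRepresentation.

Definition Kpar (K : comPzRingType) (G : groupType) : kalgebra K :=
  monoid_kalg K (exel_monoid G).

Section PartialGroupAlgebra.
Variables (K : comPzRingType) (G : groupType).
Implicit Types s t g h : G.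

Local Notation KG := (kalg_ring (Kpar K G)).

Definition kpar_basis (x : exel_monoid G) : KG := malg_basis K x.
Definition kpar (t : G) : KG := kpar_basis (exel_gen t).
Lemma kpar_basisM x y : kpar_basis (x * y)%g = kpar_basis x * kpar_basis y.
Proof. exact: malg_basisM. Qed.

Lemma kpar_basis1 : kpar_basis 1%g = 1.
Proof. exact: malg_basis1. Qed.

Opaque kpar_basis.

Lemma kpar1 : kpar 1%g = 1.
Proof. by rewrite /kpar exel_gen1 kpar_basis1. Qed.

Lemma kparl s t :
  kpar (s^-1)%g * kpar s * kpar t = kpar (s^-1)%g * kpar (s * t)%g.
Proof. by rewrite /kpar -!kpar_basisM exel_genl. Qed.

Lemma kparr s t :
  kpar s * kpar t * kpar (t^-1)%g = kpar (s * t)%g * kpar (t^-1)%g.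
Proof. by rewrite /kpar -!kpar_basisM exel_genr. Qed.

Definition kpar_e (t : G) : KG := kpar t * kpar (t^-1)%g.

Lemma kpar_e1 : kpar_e 1%g = 1.
Proof. by rewrite /kpar_e invg1 kpar1 mulr1. Qed.

Lemma kparMV t : kpar t * kpar (t^-1)%g = kpar_e t.
Proof. by []. Qed.

Lemma kparVM t : kpar (t^-1)%g * kpar t = kpar_e (t^-1)%g.
Proof. by rewrite /kpar_e invgK. Qed.

Lemma kpar_eK t : kpar_e t * kpar t = kpar t.
Proof. exact: prep_eK kpar1 kparl t. Qed.

Lemma kparVK t : kpar t * kpar_e (t^-1)%g = kpar t.
Proof. exact: prepVK kpar1 kparl t. Qed.

Lemma kpar_ee t : kpar_e t * kpar_e t = kpar_e t.
Proof. exact: prep_ee kpar1 kparl t. Qed.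

Lemma kpar_eC s t : kpar s * kpar_e t = kpar_e (s * t)%g * kpar s.
Proof. exact: prep_eC kparl kparr s t. Qed.

Lemma kpar_eCV s t : kpar_e t * kpar s = kpar s * kpar_e (s^-1 * t)%g.
Proof. exact: prep_eCV kparl kparr s t. Qed.

Lemma kparMe g h :
  kpar g * kpar h * kpar_e (h^-1)%g = kpar (g * h)%g * kpar_e (h^-1)%g.
Proof. exact: prepMe kparr g h. Qed.

Lemma kpareM g h : kpar_e g * (kpar g * kpar h) = kpar_e g * kpar (g * h)%g.
Proof. exact: prepeM kpar1 kparl g h. Qed.

End PartialGroupAlgebra.

Opaque kpar kpar_e.

Section InducedPartialAction.
Variables (K : comPzRingType) (G : groupType).

Section Left.
Variables (Y : lmodType K) (l : lact (Kpar K G) Y).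

Definition ind_ldom (g : G) : set Y := range (l (kpar_e K g)).
Definition ind_lmap (g : G) (y : Y) : Y := l (kpar K g) y.

Lemma ind_ldomP g y : ind_ldom g y <-> l (kpar_e K g) y = y.
Proof.
split=> [[z _ <-]|<-]; last by exists y.
by rewrite -lactM kpar_ee.
Qed.

Fact ind_lsubmod g : is_submod (ind_ldom g).
Proof.
apply/submodP; split=> [|k u v].
  by apply/ind_ldomP; apply: (linear0 (lact_lin l _)).
move=> /ind_ldomP uE /ind_ldomP vE; apply/ind_ldomP.
by rewrite -{2}uE -{2}vE; apply: (linearP (lact_lin l _)).
Qed.

Fact ind_llinear g k y z : ind_ldom (g^-1)%g y -> ind_ldom (g^-1)%g z ->
  ind_lmap g (k *: y + z) = k *: ind_lmap g y + ind_lmap g z.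
Proof. by move=> _ _; apply: (linearP (lact_lin l _)). Qed.

Fact ind_lmap_dom g y : ind_ldom g (ind_lmap g y).
Proof. by apply/ind_ldomP; rewrite /ind_lmap -lactM kpar_eK. Qed.

Fact ind_lmapVK g y : ind_ldom g y -> ind_lmap g (ind_lmap (g^-1)%g y) = y.
Proof. by move=> /ind_ldomP yg; rewrite /ind_lmap -lactM kparMV. Qed.

Fact ind_lbij g : set_bij (ind_ldom (g^-1)%g) (ind_ldom g) (ind_lmap g).
Proof.
split=> [_ [y _ <-]|y z|y yg]; first exact: ind_lmap_dom.
  move=> /set_mem/ind_lmapVK yE /set_mem/ind_lmapVK zE yz.
  by rewrite -yE -zE invgK yz.
exists (ind_lmap (g^-1)%g y); last exact: ind_lmapVK.
exact: ind_lmap_dom.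
Qed.

Fact ind_ldom1 : ind_ldom 1%g = setT.
Proof.
apply/seteqP; split=> // y _; apply/ind_ldomP.
by rewrite kpar_e1 lact1.
Qed.

Fact ind_lmap1 y : ind_lmap 1%g y = y.
Proof. by rewrite /ind_lmap kpar1 lact1. Qed.

Fact ind_lsub g h :
  ind_lmap g @` (ind_ldom (g^-1)%g `&` ind_ldom (g^-1 * h)%g)
  `<=` ind_ldom g `&` ind_ldom h.
Proof.
move=> _ [y [_ /ind_ldomP yh] <-]; split; first exact: ind_lmap_dom.
by apply/ind_ldomP; rewrite /ind_lmap -lactM kpar_eCV lactM yh.
Qed.

Fact ind_lmapM g h y :
  (ind_ldom (h^-1)%g `&` ind_ldom (h^-1 * g^-1)%g) y ->
  ind_lmap g (ind_lmap h y) = ind_lmap (g * h)%g y.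
Proof.
case=> /ind_ldomP yh _; apply: etrans (esym (lactM l _ _ _)) _.
exact: lact_cancel yh (kparMe K g h).
Qed.

Definition ind_lpaction : lpaction G Y :=
  LPAction ind_lsubmod ind_llinear ind_lbij ind_ldom1 ind_lmap1 ind_lsub
    ind_lmapM.

End Left.

Section Right.
Variables (X : lmodType K) (r : ract (Kpar K G) X).

Definition ind_rdom (g : G) : set X := range (r^~ (kpar_e K (g^-1)%g)).
Definition ind_rmap (g : G) (x : X) : X := r x (kpar K g).

Lemma ind_rdomP g x : ind_rdom g x <-> r x (kpar_e K (g^-1)%g) = x.
Proof.
split=> [[z _ <-]|<-]; last by exists x.
by rewrite -ractM kpar_ee.
Qed.

Fact ind_rsubmod g : is_submod (ind_rdom g).
Proof.
apply/submodP; split=> [|k u v].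
  by apply/ind_rdomP; apply: (linear0 (ract_lin r _)).
move=> /ind_rdomP uE /ind_rdomP vE; apply/ind_rdomP.
by rewrite -{2}uE -{2}vE; apply: (linearP (ract_lin r _)).
Qed.

Fact ind_rlinear g k x z : ind_rdom (g^-1)%g x -> ind_rdom (g^-1)%g z ->
  ind_rmap g (k *: x + z) = k *: ind_rmap g x + ind_rmap g z.
Proof. by move=> _ _; apply: (linearP (ract_lin r _)). Qed.

Fact ind_rmap_dom g x : ind_rdom g (ind_rmap g x).
Proof. by apply/ind_rdomP; rewrite /ind_rmap -ractM kparVK. Qed.

Fact ind_rmapVK g x : ind_rdom g x -> ind_rmap g (ind_rmap (g^-1)%g x) = x.
Proof.
move=> /ind_rdomP xg; rewrite /ind_rmap -ractM.
by rewrite kparVM.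
Qed.

Fact ind_rbij g : set_bij (ind_rdom (g^-1)%g) (ind_rdom g) (ind_rmap g).
Proof.
split=> [_ [x _ <-]|x z|x xg]; first exact: ind_rmap_dom.
  move=> /set_mem/ind_rmapVK xE /set_mem/ind_rmapVK zE xz.
  by rewrite -xE -zE invgK xz.
exists (ind_rmap (g^-1)%g x); last exact: ind_rmapVK.
exact: ind_rmap_dom.
Qed.

Fact ind_rdom1 : ind_rdom 1%g = setT.
Proof.
apply/seteqP; split=> // x _; apply/ind_rdomP.
by rewrite invg1 kpar_e1 ract1.
Qed.

Fact ind_rmap1 x : ind_rmap 1%g x = x.
Proof. by rewrite /ind_rmap kpar1 ract1. Qed.

Fact ind_rsub g h :
  ind_rmap g @` (ind_rdom h `&` ind_rdom (g^-1)%g)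
  `<=` ind_rdom (h * g)%g `&` ind_rdom g.
Proof.
move=> _ [x [/ind_rdomP xh _] <-]; split; last exact: ind_rmap_dom.
apply/ind_rdomP; rewrite /ind_rmap -ractM kpar_eC invgM mulgA mulgV mul1g.
by rewrite ractM xh.
Qed.

Fact ind_rmapM g h x :
  (ind_rdom (h^-1 * g^-1)%g `&` ind_rdom (g^-1)%g) x ->
  ind_rmap h (ind_rmap g x) = ind_rmap (g * h)%g x.
Proof.
case=> _ /ind_rdomP; rewrite invgK => xg.
apply: etrans (esym (ractM r _ _ _)) _.
exact: ract_cancel xg (kpareM K g h).
Qed.

Definition ind_rpaction : rpaction G X :=
  RPAction ind_rsubmod ind_rlinear ind_rbij ind_rdom1 ind_rmap1 ind_rsub
    ind_rmapM.

End Right.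

Lemma bimodule_lpaction (A : kalgebra K) (Y : bimodule (Kpar K G) A) :
  lpaction_ract (ind_lpaction (bimod_l Y)) (bimod_r Y).
Proof.
split=> /= g a y; last by rewrite /ind_lmap bimod_comm.
by move=> /ind_ldomP yg; apply/ind_ldomP; rewrite -bimod_comm yg.
Qed.

Lemma bimodule_rpaction (A : kalgebra K) (X : bimodule A (Kpar K G)) :
  rpaction_lact (ind_rpaction (bimod_r X)) (bimod_l X).
Proof.
split=> /= g a x; last by rewrite /ind_rmap bimod_comm.
by move=> /ind_rdomP xg; apply/ind_rdomP; rewrite bimod_comm xg.
Qed.

End InducedPartialAction.

Record mod_functor (R S : pzRingType) := ModFunctor {
  fun_obj :> lmodType R -> lmodType S;
  fun_mor : forall M N : lmodType R,
    {linear M -> N} -> {linear fun_obj M -> fun_obj N};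
  fun_mor_id : forall M : lmodType R, fun_mor (idfun : {linear M -> M}) =1 id;
  fun_mor_comp : forall (M N P : lmodType R)
    (f : {linear N -> P}) (g : {linear M -> N}),
    fun_mor (f \o g : {linear M -> P}) =1 fun_mor f \o fun_mor g }.
Arguments fun_mor [R S] _ [M N] f.

Definition functor_iso (R S : pzRingType) (F H : mod_functor R S) : Prop :=
  exists eta : forall M : lmodType R, {linear F M -> H M},
    (forall M : lmodType R, bijective (eta M)) /\
    (forall (M N : lmodType R) (f : {linear M -> N}),
       eta N \o fun_mor F f =1 fun_mor H f \o eta M).

Section LeftFunctors.
Variables (K : comPzRingType) (G : groupType) (A : kalgebra K).
Variables (X : lmodType K) (beta : rpaction G X) (Y : bimodule (Kpar K G) A).

(* M |-> (X (x)_Gpar Y) (x)_A M *)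
Let XY_act : ract A (tensG beta (ind_lpaction (bimod_l Y))) :=
  tensG_ract beta (bimodule_lpaction Y).

Definition tensGA_obj (M : lmodType A) : lmodType K :=
  tensA XY_act (restr_lact M).

Fact tensGA_id t a : idfun (XY_act t a) = XY_act (idfun t) a.
Proof. by []. Qed.

Fact restr_map_act (M N : lmodType A) (f : {linear M -> N}) a m :
  restr_map f (restr_lact M a m) = restr_lact N a (restr_map f m).
Proof. exact: linearZ. Qed.

Definition tensGA_mor (M N : lmodType A) (f : {linear M -> N}) :
    {linear tensGA_obj M -> tensGA_obj N} :=
  tensA_map tensGA_id (restr_map_act f).

Fact tensGA_mor_id (M : lmodType A) :
  tensGA_mor (idfun : {linear M -> M}) =1 id.
Proof.
apply: (qtens_ext (f := tensGA_mor _) (f' := idfun)) => t m.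
exact: tensA_mapE.
Qed.

Fact tensGA_mor_comp (M N P : lmodType A)
    (f : {linear N -> P}) (g : {linear M -> N}) :
  tensGA_mor (f \o g : {linear M -> P}) =1 tensGA_mor f \o tensGA_mor g.
Proof.
apply: (qtens_ext (f := tensGA_mor _) (f' := tensGA_mor f \o tensGA_mor g)).
by move=> t m; rewrite /= !tensA_mapE.
Qed.

Definition tensGA_functor : mod_functor A K :=
  ModFunctor tensGA_mor_id tensGA_mor_comp.

(* M |-> X (x)_Gpar (Y (x)_A M) *)
Definition tensG_tensA_act (M : lmodType A) :
    lact (Kpar K G) (tensA (bimod_r Y) (restr_lact M)) :=
  tensA_lact Y (restr_lact M).

Definition tensAG_obj (M : lmodType A) : lmodType K :=
  tensG beta (ind_lpaction (tensG_tensA_act M)).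

Fact tensAG_id y a : idfun (bimod_r Y y a) = bimod_r Y (idfun y) a.
Proof. by []. Qed.

Local Notation YA f := (tensA_map tensAG_id (restr_map_act f)).

Fact tensAG_act (M N : lmodType A) (f : {linear M -> N}) b t :
  YA f (tensG_tensA_act M b t) = tensG_tensA_act N b (YA f t).
Proof.
apply: (qtens_ext (f := YA f \o lact_lin (tensG_tensA_act M) b)
  (f' := lact_lin (tensG_tensA_act N) b \o YA f)) => y m.
rewrite -[LHS]/(YA f (tensA_lact_fun b (qpi _ (tens y m)))).
rewrite -[RHS]/(tensA_lact_fun b (YA f (qpi _ (tens y m)))).
by rewrite tensA_lactE !tensA_mapE tensA_lactE.
Qed.

Fact tensAG_morphism (M N : lmodType A) (f : {linear M -> N}) :
  lpa_morphism (ind_lpaction (tensG_tensA_act M))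
    (ind_lpaction (tensG_tensA_act N)) (YA f).
Proof.
split=> /= g t; last by move=> _; apply: tensAG_act.
by move=> /ind_ldomP tg; apply/ind_ldomP; rewrite -tensAG_act tg.
Qed.

Definition tensAG_mor (M N : lmodType A) (f : {linear M -> N}) :
    {linear tensAG_obj M -> tensAG_obj N} :=
  tensG_map (rpa_morphism_id beta) (tensAG_morphism f).

Fact tensAG_mor_id (M : lmodType A) :
  tensAG_mor (idfun : {linear M -> M}) =1 id.
Proof.
apply: (qtens_ext (f := tensAG_mor _) (f' := idfun)) => x t /=.
rewrite tensG_mapE; congr (qpi _ (tens _ _)).
apply: (qtens_ext (f := YA _) (f' := idfun)) => y m.
exact: tensA_mapE.
Qed.

Fact tensAG_mor_comp (M N P : lmodType A)
    (f : {linear N -> P}) (g : {linear M -> N}) :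
  tensAG_mor (f \o g : {linear M -> P}) =1 tensAG_mor f \o tensAG_mor g.
Proof.
apply: (qtens_ext (f := tensAG_mor _) (f' := tensAG_mor f \o tensAG_mor g)).
move=> x t /=; rewrite !tensG_mapE; congr (qpi _ (tens _ _)).
apply: (qtens_ext (f := YA _) (f' := YA f \o YA g)) => y m /=.
by rewrite !tensA_mapE.
Qed.

Definition tensAG_functor : mod_functor A K :=
  ModFunctor tensAG_mor_id tensAG_mor_comp.

End LeftFunctors.

(* The ring of kop A is A^c: right A-modules are elements of
   lmodType (kop A). *)
Section RightFunctors.
Variables (K : comPzRingType) (G : groupType) (A : kalgebra K).
Variables (Y : lmodType K) (alpha : lpaction G Y) (X : bimodule A (Kpar K G)).

(* M |-> M (x)_A (X (x)_Gpar Y) *)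
Let XY_act : lact A (tensG (ind_rpaction (bimod_r X)) alpha) :=
  tensG_lact alpha (bimodule_rpaction X).

Definition rtensGA_obj (M : lmodType (kop A)) : lmodType K :=
  tensA (restr_ract M) XY_act.

Fact rtensGA_id a t : idfun (XY_act a t) = XY_act a (idfun t).
Proof. by []. Qed.

Fact restr_map_ract (M N : lmodType (kop A)) (f : {linear M -> N}) m a :
  restr_map f (restr_ract M m a) = restr_ract N (restr_map f m) a.
Proof. exact: linearZ. Qed.

Definition rtensGA_mor (M N : lmodType (kop A)) (f : {linear M -> N}) :
    {linear rtensGA_obj M -> rtensGA_obj N} :=
  tensA_map (restr_map_ract f) rtensGA_id.

Fact rtensGA_mor_id (M : lmodType (kop A)) :
  rtensGA_mor (idfun : {linear M -> M}) =1 id.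
Proof.
apply: (qtens_ext (f := rtensGA_mor _) (f' := idfun)) => m t.
exact: tensA_mapE.
Qed.

Fact rtensGA_mor_comp (M N P : lmodType (kop A))
    (f : {linear N -> P}) (g : {linear M -> N}) :
  rtensGA_mor (f \o g : {linear M -> P}) =1 rtensGA_mor f \o rtensGA_mor g.
Proof.
apply: (qtens_ext (f := rtensGA_mor _) (f' := rtensGA_mor f \o rtensGA_mor g)).
by move=> m t; rewrite /= !tensA_mapE.
Qed.

Definition rtensGA_functor : mod_functor (kop A) K :=
  ModFunctor rtensGA_mor_id rtensGA_mor_comp.

(* M |-> (M (x)_A X) (x)_Gpar Y *)
Definition rtensA_act (M : lmodType (kop A)) :
    ract (Kpar K G) (tensA (restr_ract M) (bimod_l X)) :=
  tensA_ract (restr_ract M) X.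

Definition rtensAG_obj (M : lmodType (kop A)) : lmodType K :=
  tensG (ind_rpaction (rtensA_act M)) alpha.

Fact rtensAG_id a x : idfun (bimod_l X a x) = bimod_l X a (idfun x).
Proof. by []. Qed.

Local Notation XA f := (tensA_map (restr_map_ract f) rtensAG_id).

Fact rtensAG_act (M N : lmodType (kop A)) (f : {linear M -> N}) b t :
  XA f (rtensA_act M t b) = rtensA_act N (XA f t) b.
Proof.
apply: (qtens_ext (f := XA f \o ract_lin (rtensA_act M) b)
  (f' := ract_lin (rtensA_act N) b \o XA f)) => m x.
rewrite -[LHS]/(XA f (tensA_ract_fun (qpi _ (tens m x)) b)).
rewrite -[RHS]/(tensA_ract_fun (XA f (qpi _ (tens m x))) b).
by rewrite tensA_ractE !tensA_mapE tensA_ractE.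
Qed.

Fact rtensAG_morphism (M N : lmodType (kop A)) (f : {linear M -> N}) :
  rpa_morphism (ind_rpaction (rtensA_act M)) (ind_rpaction (rtensA_act N))
    (XA f).
Proof.
split=> /= g t; last by move=> _; apply: rtensAG_act.
by move=> /ind_rdomP tg; apply/ind_rdomP; rewrite -rtensAG_act tg.
Qed.

Definition rtensAG_mor (M N : lmodType (kop A)) (f : {linear M -> N}) :
    {linear rtensAG_obj M -> rtensAG_obj N} :=
  tensG_map (rtensAG_morphism f) (lpa_morphism_id alpha).

Fact rtensAG_mor_id (M : lmodType (kop A)) :
  rtensAG_mor (idfun : {linear M -> M}) =1 id.
Proof.
apply: (qtens_ext (f := rtensAG_mor _) (f' := idfun)) => t y /=.
rewrite tensG_mapE; apply: (congr1 (fun u => qpi _ (tens u y))).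
apply: (qtens_ext (f := XA _) (f' := idfun)) => m x.
exact: tensA_mapE.
Qed.

Fact rtensAG_mor_comp (M N P : lmodType (kop A))
    (f : {linear N -> P}) (g : {linear M -> N}) :
  rtensAG_mor (f \o g : {linear M -> P}) =1 rtensAG_mor f \o rtensAG_mor g.
Proof.
apply: (qtens_ext (f := rtensAG_mor _) (f' := rtensAG_mor f \o rtensAG_mor g)).
move=> t y /=; rewrite !tensG_mapE.
apply: (congr1 (fun u => qpi _ (tens u y))).
apply: (qtens_ext (f := XA _) (f' := XA f \o XA g)) => m x /=.
by rewrite !tensA_mapE.
Qed.

Definition rtensAG_functor : mod_functor (kop A) K :=
  ModFunctor rtensAG_mor_id rtensAG_mor_comp.

End RightFunctors.

(* Main.v *)
Require Import Defs.
From HB Require Import structures.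
From mathcomp Require Import all_boot all_algebra.
From mathcomp Require Import classical_sets.

(** Both isomorphisms are the associativity of tensor products,
    [[x (x) y] (x) z] <-> [x (x) [y (x) z]], in which one of the two tensor
    products is over A and the other is the partial one over G.

    Each of these is a quotient of a tensor product over K by the submodule
    generated by a set of relations. So take K-modules X, Y, Z and relations S
    on X (x) Y, T on Y (x) Z, U on (X (x) Y)/S (x) Z and V on X (x) (Y (x) Z)/T.
    The associator and its inverse are given by the same formula on pure
    tensors, and pure tensors generate; hence they are mutually inverse and
    natural as soon as they exist. They exist as soon as the four sets of
    relations are killed: S and U by the map to the right, T and V by the map to
    the left (the predicates [kills_*], and [assocK], [assocVK]).

    For an inner relation (S or T) this is one computation with pure tensors: a
    relation over A between two of the factors is still one after bracketing
    with the third, because the action on the larger tensor product is induced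
    by the one on the smaller; the same holds for G. For an outer relation one
    of the two entries is not a pure tensor. Over A the relation makes sense for
    every entry, so both sides are linear in it and it may be taken pure. Over
    G the entry is confined to a domain, which is a submodule of, say,
    Y (x)_A M; being a sum of pure tensors there does not make it a sum of pure
    tensors whose first factors lie in the domain of Y. Here it matters that the
    partial action comes from a K_par G-module: the domain is the image of some
    idempotent e_g, the entry is e_g . q with q arbitrary, and linearity in q
    reduces the claim to e_g . [y (x) z] = [e_g . y (x) z].

    The first statement is the case where S and V are relations over G and T
    and U relations over A; the second one exchanges the roles and uses the
    inverse associator. *)

Set Implicit Arguments.
Unset Strict Implicit.
Unset Printing Implicit Defensive.

Import GRing.Theory.
Local Open Scope classical_set_scope.
Local Open Scope ring_scope.

(** * Maps out of iterated quotients of tensor products *)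

Section QuotientTensor.
Variables (K : comPzRingType) (X Y : lmodType K).

Definition qtens (S : set (tensK X Y)) (x : X) (y : Y) : quotmod S :=
  qpi S (tens x y).

(** [tens x y] with one argument fixed, as linear maps, so that composites with
    them fall under the extensionality lemmas below. *)
Definition tens_l (y : Y) (x : X) : tensK X Y := tens x y.
Definition tens_r (x : X) (y : Y) : tensK X Y := tens x y.

Fact tens_l_linear y : linear (tens_l y).
Proof. exact: (tens_bilinear X Y).1. Qed.
HB.instance Definition _ y :=
  GRing.isLinear.Build K X (tensK X Y) *:%R (tens_l y) (tens_l_linear y).

Fact tens_r_linear x : linear (tens_r x).
Proof. exact: (tens_bilinear X Y).2. Qed.
HB.instance Definition _ x :=
  GRing.isLinear.Build K Y (tensK X Y) *:%R (tens_r x) (tens_r_linear x).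

End QuotientTensor.

Section Ext.
Variables (K : comPzRingType) (X Y Z W : lmodType K).

Lemma tens3l_ext (S : set (tensK X Y))
    (f f' : {linear tensK (quotmod S) Z -> W}) :
  (forall x y z, f (tens (qtens S x y) z) = f' (tens (qtens S x y) z)) ->
  f =1 f'.
Proof.
move=> ff'; apply: tens_ext => p z.
apply: (qtens_ext (f := f \o tens_l z) (f' := f' \o tens_l z)) => x y.
exact: ff'.
Qed.

Lemma tens3r_ext (T : set (tensK Y Z))
    (f f' : {linear tensK X (quotmod T) -> W}) :
  (forall x y z, f (tens x (qtens T y z)) = f' (tens x (qtens T y z))) ->
  f =1 f'.
Proof.
move=> ff'; apply: tens_ext => x q.
apply: (qtens_ext (f := f \o tens_r x) (f' := f' \o tens_r x)) => y z.
exact: ff'.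
Qed.

Lemma qtens3l_ext (S : set (tensK X Y)) (U : set (tensK (quotmod S) Z))
    (f f' : {linear quotmod U -> W}) :
  (forall x y z, f (qtens U (qtens S x y) z) = f' (qtens U (qtens S x y) z)) ->
  f =1 f'.
Proof.
move=> ff'; apply: qtens_ext => p z.
exact: (tens3l_ext (f := f \o qpi U) (f' := f' \o qpi U)).
Qed.

Lemma qtens3r_ext (T : set (tensK Y Z)) (V : set (tensK X (quotmod T)))
    (f f' : {linear quotmod V -> W}) :
  (forall x y z, f (qtens V x (qtens T y z)) = f' (qtens V x (qtens T y z))) ->
  f =1 f'.
Proof.
move=> ff'; apply: qtens_ext => x q.
exact: (tens3r_ext (f := f \o qpi V) (f' := f' \o qpi V)).
Qed.

Lemma qtens_bilinear (S : set (tensK X Y)) : is_bilinear (qtens S).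
Proof.
split=> [y|x] k u v; rewrite /qtens -linearP; congr (qpi S _).
- exact: tens_l_linear.
- exact: tens_r_linear.
Qed.

End Ext.

(** * The associator of two quotients of tensor products *)

Section Associator.
Variables (K : comPzRingType) (X Y Z : lmodType K).
Variables (S : set (tensK X Y)) (T : set (tensK Y Z)).
Variables (U : set (tensK (quotmod S) Z)) (V : set (tensK X (quotmod T))).

Local Notation lt x y z := (qtens U (qtens S x y) z).
Local Notation rt x y z := (qtens V x (qtens T y z)).

(** The predicates do not mention a constructed map: they say that every linear
    map with the expected values on pure tensors kills the relation. There is at
    most one such map, and for S and T it exists unconditionally; for U and V it
    exists once S and T are killed. *)
Definition kills_inner_l : Prop :=
  forall z (f : {linear tensK X Y -> quotmod V}),
    (forall x y, f (tens x y) = rt x y z) -> forall s, S s -> f s = 0.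
Definition kills_outer_l : Prop :=
  forall f : {linear tensK (quotmod S) Z -> quotmod V},
    (forall x y z, f (tens (qtens S x y) z) = rt x y z) ->
  forall u, U u -> f u = 0.
Definition kills_inner_r : Prop :=
  forall x (f : {linear tensK Y Z -> quotmod U}),
    (forall y z, f (tens y z) = lt x y z) -> forall t, T t -> f t = 0.
Definition kills_outer_r : Prop :=
  forall f : {linear tensK X (quotmod T) -> quotmod U},
    (forall x y z, f (tens x (qtens T y z)) = lt x y z) ->
  forall v, V v -> f v = 0.

Section LeftToRight.
Hypotheses (hS : kills_inner_l) (hU : kills_outer_l).

Fact assoc_bilinear_xy z : is_bilinear (fun x y => rt x y z).
Proof.
have [Tl _] := qtens_bilinear T; have [Vl Vr] := qtens_bilinear V.
by split=> [y|x] k a b; [apply: Vl|rewrite Tl Vr].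
Qed.

Fact assoc_inner z s : S s -> tlift (assoc_bilinear_xy z) s = 0.
Proof. by apply: (hS (z := z)) => x y; apply: tliftE. Qed.

(** The associator is built in two steps, as the map is bilinear in
    [x (x) y] and z: first with z fixed, on the quotient by S. *)
Definition assoc_xy (z : Z) : quotmod S -> quotmod V :=
  qlift (assoc_inner z).
HB.instance Definition _ (z : Z) :=
  GRing.isLinear.Build K (quotmod S) (quotmod V) *:%R (assoc_xy z)
    (linearP (qlift (assoc_inner z))).

Lemma assoc_xyE z x y : assoc_xy z (qtens S x y) = rt x y z.
Proof. exact: etrans (qliftE _ _) (tliftE _ _ _). Qed.

Fact assoc_bilinear : is_bilinear (fun p z => assoc_xy z p).
Proof.
split=> [z|p k z z']; first exact: linearP.
apply: (qtens_ext (f := assoc_xy (k *: z + z'))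
  (f' := k \*: assoc_xy z \+ assoc_xy z')) => x y /=.
by rewrite !assoc_xyE (qtens_bilinear T).2 (qtens_bilinear V).2.
Qed.

Fact assoc_outer u : U u -> tlift assoc_bilinear u = 0.
Proof.
apply: hU => x y z; apply: etrans (tliftE assoc_bilinear _ _) _.
exact: assoc_xyE.
Qed.

Definition assoc : quotmod U -> quotmod V :=
  qlift assoc_outer.
HB.instance Definition _ :=
  GRing.isLinear.Build K (quotmod U) (quotmod V) *:%R assoc
    (linearP (qlift assoc_outer)).

Lemma assocE x y z : assoc (lt x y z) = rt x y z.
Proof.
apply: etrans (qliftE assoc_outer _) _.
exact: etrans (tliftE assoc_bilinear _ _) (assoc_xyE _ _ _).
Qed.

End LeftToRight.

Section RightToLeft.
Hypotheses (hT : kills_inner_r) (hV : kills_outer_r).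

Fact assocV_bilinear_yz x : is_bilinear (fun y z => lt x y z).
Proof.
have [_ Sr] := qtens_bilinear S; have [Ul Ur] := qtens_bilinear U.
by split=> [z|y] k a b; [rewrite Sr Ul|apply: Ur].
Qed.

Fact assocV_inner x t : T t -> tlift (assocV_bilinear_yz x) t = 0.
Proof. by apply: (hT (x := x)) => y z; apply: tliftE. Qed.

Definition assocV_yz (x : X) : quotmod T -> quotmod U :=
  qlift (assocV_inner x).
HB.instance Definition _ (x : X) :=
  GRing.isLinear.Build K (quotmod T) (quotmod U) *:%R (assocV_yz x)
    (linearP (qlift (assocV_inner x))).

Lemma assocV_yzE x y z : assocV_yz x (qtens T y z) = lt x y z.
Proof. exact: etrans (qliftE _ _) (tliftE _ _ _). Qed.

Fact assocV_bilinear : is_bilinear assocV_yz.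
Proof.
split=> [q k x x'|x]; last exact: linearP.
apply: (qtens_ext (f := assocV_yz (k *: x + x'))
  (f' := k \*: assocV_yz x \+ assocV_yz x')) => y z /=.
by rewrite !assocV_yzE (qtens_bilinear S).1 (qtens_bilinear U).1.
Qed.

Fact assocV_outer v : V v -> tlift assocV_bilinear v = 0.
Proof.
apply: hV => x y z; apply: etrans (tliftE assocV_bilinear _ _) _.
exact: assocV_yzE.
Qed.

Definition assocV : quotmod V -> quotmod U :=
  qlift assocV_outer.
HB.instance Definition _ :=
  GRing.isLinear.Build K (quotmod V) (quotmod U) *:%R assocV
    (linearP (qlift assocV_outer)).

Lemma assocVE x y z : assocV (rt x y z) = lt x y z.
Proof.
apply: etrans (qliftE assocV_outer _) _.
exact: etrans (tliftE assocV_bilinear _ _) (assocV_yzE _ _ _).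
Qed.

End RightToLeft.

Section Inverse.
Hypotheses (hS : kills_inner_l) (hU : kills_outer_l).
Hypotheses (hT : kills_inner_r) (hV : kills_outer_r).

Lemma assocK : cancel (assoc hS hU) (assocV hT hV).
Proof.
apply: (qtens3l_ext (f := assocV hT hV \o assoc hS hU) (f' := idfun)).
by move=> x y z /=; rewrite assocE assocVE.
Qed.

Lemma assocVK : cancel (assocV hT hV) (assoc hS hU).
Proof.
apply: (qtens3r_ext (f := assoc hS hU \o assocV hT hV) (f' := idfun)).
by move=> x y z /=; rewrite assocVE assocE.
Qed.

End Inverse.
End Associator.

(** * Relations over the algebra and over the group *)

Section Relations.
Variables (K : comPzRingType) (G : groupType) (A B : kalgebra K).

Lemma qpi_rel (V : lmodType K) (S : set V) u v :
  S (u - v) -> qpi S u = qpi S v.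
Proof. by move=> Suv; apply/qpi_eq; apply: Defs.sub_span. Qed.

Lemma tensA_balanced (X N : lmodType K) (r : ract A X) (l : lact A N) x a n :
  qtens (tensA_rel r l) (r x a) n = qtens (tensA_rel r l) x (l a n).
Proof. by apply: qpi_rel; exists x, a, n. Qed.

Lemma tensG_balanced (X Y : lmodType K) (beta : rpaction G X)
    (alpha : lpaction G Y) g x y :
  rpa_dom beta (g^-1)%g x -> lpa_dom alpha (g^-1)%g y ->
  qtens (tensG_rel beta alpha) (rpa_map beta g x) y =
  qtens (tensG_rel beta alpha) x (lpa_map alpha g y).
Proof. by move=> xg yg; apply: qpi_rel; exists g, x, y. Qed.

Lemma tensG_ract_pure (X Y : lmodType K) (beta : rpaction G X)
    (alpha : lpaction G Y) (r : ract A Y) (rP : lpaction_ract alpha r) x y a :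
  tensG_ract beta rP (qtens (tensG_rel beta alpha) x y) a =
  qtens (tensG_rel beta alpha) x (r y a).
Proof. exact: tensG_ractE. Qed.

Lemma tensG_lact_pure (X Y : lmodType K) (beta : rpaction G X)
    (alpha : lpaction G Y) (l : lact A X) (lP : rpaction_lact beta l) a x y :
  tensG_lact alpha lP a (qtens (tensG_rel beta alpha) x y) =
  qtens (tensG_rel beta alpha) (l a x) y.
Proof. exact: tensG_lactE. Qed.

Lemma tensA_lact_pure (Y : bimodule B A) (N : lmodType K) (l : lact A N) b y n :
  tensA_lact Y l b (qtens (tensA_rel (bimod_r Y) l) y n) =
  qtens (tensA_rel (bimod_r Y) l) (bimod_l Y b y) n.
Proof. exact: tensA_lactE. Qed.

Lemma tensA_ract_pure (M : lmodType K) (r : ract A M) (X : bimodule A B) m x b :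
  tensA_ract r X (qtens (tensA_rel r (bimod_l X)) m x) b =
  qtens (tensA_rel r (bimod_l X)) m (bimod_r X x b).
Proof. exact: tensA_ractE. Qed.

End Relations.

(** In the next four sections, one pair of relations is arbitrary (it comes from
    the other tensor product), and the other pair comes from an action on Y and
    from an action on a quotient tensor product involving Y that acts through
    Y, as [actE] says. *)

Section AlgebraOnTheRight.
Variables (K : comPzRingType) (A : kalgebra K) (X Y Z : lmodType K).
Variables (S : set (tensK X Y)) (r : ract A Y) (l : lact A Z).
Variables (act : ract A (quotmod S)).
Let T := tensA_rel r l.
Let U := tensA_rel act l.
Variable V : set (tensK X (quotmod T)).
Hypothesis actE : forall x y a, act (qtens S x y) a = qtens S x (r y a).

Lemma tensA_kills_inner_r : kills_inner_r (S := S) T U.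
Proof.
move=> x f fE _ [y [a [z ->]]].
by apply/eqP; rewrite linearB subr_eq0 !fE -actE tensA_balanced.
Qed.

(** Both sides of a relation in U are linear in its first entry, so that entry
    may be taken to be [x (x) y]; there the action moves to y, and then across
    to z. *)
Lemma tensA_kills_outer_l : kills_outer_l U V.
Proof.
move=> f fE _ [p [a [z ->]]].
apply/eqP; rewrite linearB subr_eq0; apply/eqP; move: p.
apply: (qtens_ext (f := f \o tens_l z \o ract_lin act a)
  (f' := f \o tens_l (l a z))) => x y.
rewrite -[LHS]/(f (tens (act (qtens S x y) a) z)).
by rewrite actE [RHS]fE fE tensA_balanced.
Qed.

End AlgebraOnTheRight.

Section AlgebraOnTheLeft.
Variables (K : comPzRingType) (A : kalgebra K) (X Y Z : lmodType K).
Variables (T : set (tensK Y Z)) (r : ract A X) (l : lact A Y).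
Variables (act : lact A (quotmod T)).
Let S := tensA_rel r l.
Let V := tensA_rel r act.
Variable U : set (tensK (quotmod S) Z).
Hypothesis actE : forall a y z, act a (qtens T y z) = qtens T (l a y) z.

Lemma tensA_kills_inner_l : kills_inner_l (T := T) S V.
Proof.
move=> z f fE _ [x [a [y ->]]].
by apply/eqP; rewrite linearB subr_eq0 !fE -actE tensA_balanced.
Qed.

Lemma tensA_kills_outer_r : kills_outer_r U V.
Proof.
move=> f fE _ [x [a [q ->]]].
apply/eqP; rewrite linearB subr_eq0; apply/eqP; move: q.
apply: (qtens_ext (f := f \o tens_r (r x a))
  (f' := f \o tens_r x \o lact_lin act a)) => y z.
rewrite -[RHS]/(f (tens x (act a (qtens T y z)))).
by rewrite actE [LHS]fE fE tensA_balanced.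
Qed.

End AlgebraOnTheLeft.

Section GroupOnTheLeft.
Variables (K : comPzRingType) (G : groupType) (X Y Z : lmodType K).
Variables (T : set (tensK Y Z)) (beta : rpaction G X).
Variables (l : lact (Kpar K G) Y) (act : lact (Kpar K G) (quotmod T)).
Let S := tensG_rel beta (ind_lpaction l).
Let V := tensG_rel beta (ind_lpaction act).
Variable U : set (tensK (quotmod S) Z).
Hypothesis actE : forall b y z, act b (qtens T y z) = qtens T (l b y) z.

(** Bracketing with z maps the domains of Y to those of the quotient by T,
    again because the domains are images of the same idempotents. *)
Lemma tensG_kills_inner_l : kills_inner_l (T := T) S V.
Proof.
move=> z f fE _ [g [x [_ [xg [y _ <-] ->]]]].
apply/eqP; rewrite linearB subr_eq0 !fE; apply/eqP.
apply: etrans (tensG_balanced (alpha := ind_lpaction act) xg _) _.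
  by rewrite -actE; exists (qtens T y z).
by congr (qtens V x _); exact: actE.
Qed.

(** The second entry of a relation in V is e . q for the idempotent e of the
    domain; that e . q lies in the domain imposes nothing on q, which may
    therefore be taken to be [y (x) z], and then e . y lies in the domain of the
    partial action on Y. *)
Lemma tensG_kills_outer_r : kills_outer_r U V.
Proof.
move=> f fE _ [g [x [_ [xg [q _ <-] ->]]]].
apply/eqP; rewrite linearB subr_eq0; apply/eqP.
pose e := kpar_e K g^-1%g; move: q.
apply: (qtens_ext (f := f \o tens_r (rpa_map beta g x) \o lact_lin act e)
  (f' := f \o tens_r x \o lact_lin act (kpar K g) \o lact_lin act e)) => y z.
rewrite -[LHS]/(f (tens (rpa_map beta g x) (act e (qtens T y z)))).
rewrite -[RHS]/(f (tens x (act (kpar K g) (act e (qtens T y z))))).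
rewrite !actE [LHS]fE [RHS]fE; congr (qtens U _ z).
by apply: (tensG_balanced (alpha := ind_lpaction l) xg); exists y.
Qed.

End GroupOnTheLeft.

Section GroupOnTheRight.
Variables (K : comPzRingType) (G : groupType) (X Y Z : lmodType K).
Variables (S : set (tensK X Y)) (alpha : lpaction G Z).
Variables (r : ract (Kpar K G) Y) (act : ract (Kpar K G) (quotmod S)).
Let T := tensG_rel (ind_rpaction r) alpha.
Let U := tensG_rel (ind_rpaction act) alpha.
Variable V : set (tensK X (quotmod T)).
Hypothesis actE : forall x y b, act (qtens S x y) b = qtens S x (r y b).

Lemma tensG_kills_inner_r : kills_inner_r (S := S) T U.
Proof.
move=> x f fE _ [g [_ [z [[y _ <-] zg ->]]]].
apply/eqP; rewrite linearB subr_eq0 !fE; apply/eqP.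
apply: etrans _ (tensG_balanced (beta := ind_rpaction act) _ zg).
  by congr (qtens U _ z); exact: esym (actE _ _ _).
by rewrite -actE; exists (qtens S x y).
Qed.

(** As for [tensG_kills_outer_r], with the first entry p . e of a relation in
    U. *)
Lemma tensG_kills_outer_l : kills_outer_l U V.
Proof.
move=> f fE _ [g [_ [z [[p _ <-] zg ->]]]].
apply/eqP; rewrite linearB subr_eq0; apply/eqP.
(* The domain X_h of an induced right partial action is X . e_(h^-1); here h is
   itself the inverse of g. *)
pose e := kpar_e K (g^-1)^-1%g; move: p.
apply: (qtens_ext
  (f := f \o tens_l z \o ract_lin act (kpar K g) \o ract_lin act e)
  (f' := f \o tens_l (lpa_map alpha g z) \o ract_lin act e)) => x y.
rewrite -[LHS]/(f (tens (act (act (qtens S x y) e) (kpar K g)) z)).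
rewrite -[RHS]/(f (tens (act (qtens S x y) e) (lpa_map alpha g z))).
rewrite !actE [LHS]fE [RHS]fE; congr (qtens V x _).
by apply: (tensG_balanced (beta := ind_rpaction r) _ zg); exists y.
Qed.

End GroupOnTheRight.

(** * The four functors on pure tensors, and the isomorphisms *)

Section FunctorsOnPureTensors.
Variables (K : comPzRingType) (G : groupType) (A : kalgebra K).

Lemma tensGA_mor_pure (X : lmodType K) (beta : rpaction G X)
    (Y : bimodule (Kpar K G) A) (M N : lmodType A) (f : {linear M -> N}) p m :
  tensGA_mor beta Y f (qtens _ p m) = qtens _ p (restr_map f m).
Proof. exact: tensA_mapE. Qed.

Lemma tensAG_mor_pure (X : lmodType K) (beta : rpaction G X)
    (Y : bimodule (Kpar K G) A) (M N : lmodType A) (f : {linear M -> N}) x y m :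
  tensAG_mor beta Y f (qtens _ x (qtens _ y m)) =
  qtens _ x (qtens _ y (restr_map f m)).
Proof.
apply: etrans (tensG_mapE _ _ _ _) _.
by congr (qpi _ (tens _ _)); exact: tensA_mapE.
Qed.

Lemma rtensGA_mor_pure (Y : lmodType K) (alpha : lpaction G Y)
    (X : bimodule A (Kpar K G)) (M N : lmodType (kop A)) (f : {linear M -> N})
    m p :
  rtensGA_mor alpha X f (qtens _ m p) = qtens _ (restr_map f m) p.
Proof. exact: tensA_mapE. Qed.

Lemma rtensAG_mor_pure (Y : lmodType K) (alpha : lpaction G Y)
    (X : bimodule A (Kpar K G)) (M N : lmodType (kop A)) (f : {linear M -> N})
    m x y :
  rtensAG_mor alpha X f (qtens _ (qtens _ m x) y) =
  qtens _ (qtens _ (restr_map f m) x) y.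
Proof.
apply: etrans (tensG_mapE _ _ _ _) _.
by apply: (congr1 (fun p => qpi _ (tens p y))); exact: tensA_mapE.
Qed.

End FunctorsOnPureTensors.

Theorem proposition2p20 (K : comPzRingType) (G : groupType) (A : kalgebra K) :
  (forall (X : lmodType K) (beta : rpaction G X) (Y : bimodule (Kpar K G) A),
     functor_iso (tensGA_functor beta Y) (tensAG_functor beta Y))
  /\
  (forall (Y : lmodType K) (alpha : lpaction G Y) (X : bimodule A (Kpar K G)),
     functor_iso (rtensGA_functor alpha X) (rtensAG_functor alpha X)).
Proof.
split=> [X beta Y|Y alpha X].
- have XYE := tensG_ract_pure beta (bimodule_lpaction Y).
  have YME (M : lmodType A) := @tensA_lact_pure _ _ _ Y _ (restr_lact M).
  pose F := tensGA_functor beta Y; pose H := tensAG_functor beta Y.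
  pose eta (M : lmodType A) : {linear F M -> H M} :=
    assoc (tensG_kills_inner_l (beta := beta) (YME M))
      (tensA_kills_outer_l (l := restr_lact M) XYE).
  exists eta; split=> [M|M N f].
    by exists (assocV (tensA_kills_inner_r (l := restr_lact M) XYE)
                (tensG_kills_outer_r (YME M)));
      [apply: assocK|apply: assocVK].
  apply: (qtens3l_ext (f := eta N \o fun_mor F f)
    (f' := fun_mor H f \o eta M)) => x y m.
  apply: etrans (congr1 (eta N) (tensGA_mor_pure f _ m)) _.
  apply: etrans (assocE _ _ x y (restr_map f m)) (esym _).
  apply: etrans (congr1 (fun_mor H f) (assocE _ _ x y m)) _.
  exact: tensAG_mor_pure.
- have XYE := tensG_lact_pure alpha (bimodule_rpaction X).
  have MXE (M : lmodType (kop A)) := @tensA_ract_pure _ _ _ _ (restr_ract M) X.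
  pose F := rtensGA_functor alpha X; pose H := rtensAG_functor alpha X.
  pose eta (M : lmodType (kop A)) : {linear F M -> H M} :=
    assocV (tensG_kills_inner_r (alpha := alpha) (MXE M))
      (tensA_kills_outer_r (r := restr_ract M) XYE).
  exists eta; split=> [M|M N f].
    by exists (assoc (tensA_kills_inner_l (r := restr_ract M) XYE)
                (tensG_kills_outer_l (MXE M)));
      [apply: assocVK|apply: assocK].
  apply: (qtens3r_ext (f := eta N \o fun_mor F f)
    (f' := fun_mor H f \o eta M)) => m x y.
  apply: etrans (congr1 (eta N) (rtensGA_mor_pure f m _)) _.
  apply: etrans (assocVE _ _ (restr_map f m) x y) (esym _).
  apply: etrans (congr1 (fun_mor H f) (assocVE _ _ m x y)) _.
  exact: rtensAG_mor_pure.
Qed.
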